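(* Let $d>1$, let $\{f_n\}_{n\ge 1}$ be a $d$-decaying Gauss like iterated function system on $[0,1]$, and let $\{a_n(x)\}_{n\ge1}$ denote the digits of $x$ in this system. Let $m\ge1$ be an integer, let $t_0,\dots,t_m$ be non-negative real numbers with $t_0\ne0$ and $t_i\neq 0$ for at least one $1\le i\le m$, and let $\Sigma_t=\sum_{0\le i\le m}t_i$. Put $$\Lambda=\{x\in(0,1):\ a_n(x)\le a_{n+1}(x)\ \text{ for all } n\ge1\}$$ and, for $0\le\alpha\le\infty$, $$E(\Lambda,\alpha,\{t_i\}_{0\le i\le m})=\Big\{x\in\Lambda:\ \liminf_{n\to\infty}\frac{\log\big(a_n(x)^{t_0}a_{n+1}(x)^{t_1}\cdots a_{n+m}(x)^{t_m}\big)}{\log n}=\alpha\Big\}.$$ Then for every $0\le\alpha\le\infty$, $$\dim_{\rm H}E(\Lambda,\alpha,\{t_i\}_{0\le i\le m})=\begin{cases}0, & 0\le\alpha<\Sigma_t,\\[2pt] \dfrac{\alpha-\Sigma_t}{d\alpha}, & \Sigma_t\le\alpha<\infty,\\[6pt] \dfrac1d, & \alpha=\infty,\end{cases}$$ where $\dim_{\rm H}$ denotes Hausdorff dimension.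
   Context: $\mathbb{N}=\{1,2,3,\dots\}$. Let $d>1$. A sequence $\{f_n\}_{n\ge1}$ of $C^1$ functions $f_n:[0,1]\to[0,1]$ is a $d$-decaying Gauss like iterated function system if: (i) (open set condition) $f_i((0,1))\cap f_j((0,1))=\emptyset$ for all $i\ne j$ in $\mathbb{N}$; (ii) (contraction) there exist $q\in\mathbb{N}$ and $0<\rho<1$ such that $0<|(f_{a_1}\circ\cdots\circ f_{a_q})'(x)|\le\rho<1$ for all $(a_1,\dots,a_q)\in\mathbb{N}^q$ and $x\in[0,1]$; (iii) (regularity) for every $\varepsilon>0$ there are constants $C_1=C_1(\varepsilon)>0$, $C_2=C_2(\varepsilon)>0$ such that for each $i\in\mathbb{N}$ there are constants $\xi_i,\lambda_i$ with $\xi_i\le|f_i'(x)|\le\lambda_i$ for all $x\in[0,1]$ and $\frac{C_1}{i^{d+\varepsilon}}\le\xi_i\le\lambda_i\le\frac{C_2}{i^{d-\varepsilon}}$; (iv) $\bigcup_{i=1}^\infty f_i([0,1])=(0,1]$, and $f_i(x)<f_j(x)$ whenever $i>j$; (v) (bounded distortion) there is $\kappa\ge1$ such that for every $n\in\mathbb{N}$ and $(a_1,\dots,a_n)\in\mathbb{N}^n$, $|(f_{a_1}\circ\cdots\circ f_{a_n})'(x)|\le\kappa\,|(f_{a_1}\circ\cdots\circ f_{a_n})'(y)|$ for all $x,y\in[0,1]$. Digits: for $\underline a=\{a_n\}_{n\ge1}\in\mathbb{N}^{\mathbb{N}}$ put $\Pi(\underline a)=\lim_{n\to\infty}f_{a_1}\circ\cdots\circ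 f_{a_n}(1)$. For all but countably many $x\in(0,1)$ there is exactly one $\underline a\in\mathbb{N}^{\mathbb{N}}$ with $\Pi(\underline a)=x$; its entries are the digits of $x$, written $a_n(x)$. Sets defined by digits are understood to consist of such points $x$ only (countable sets do not affect Hausdorff dimension). *)

(* Defs.v *)
From mathcomp Require Import all_boot all_order all_algebra.
From mathcomp Require Import all_classical all_reals all_analysis.

Set Implicit Arguments.
Unset Strict Implicit.
Unset Printing Implicit Defensive.

Import Order.TTheory GRing.Theory Num.Theory.
Import numFieldNormedType.Exports.

Local Open Scope classical_set_scope.
Local Open Scope ring_scope.

Section C1_on_unit_interval.
Context {R : realType}.
Implicit Types (g : R -> R) (x : R).

(* Derivatives are taken relative to [0, 1], hence one-sided at 0 and 1, and
   the values of a map outside [0, 1] are irrelevant. *)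
Definition slope01 g x := (g y - g x) / (y - x) @[y --> within `[0, 1] x^'].

Definition deriv01 g x : R := lim (slope01 g x).

Definition C1_01 g :=
  (forall x, x \in `[0, 1] -> cvg (slope01 g x)) /\
  {within `[0, 1], continuous (deriv01 g)}.

End C1_on_unit_interval.

Section gauss_like_systems.
Context {R : realType}.
Implicit Types (f : nat -> R -> R) (w : seq nat) (a : nat -> nat) (x : R).

(* Throughout, the positive integers index the maps and the positions of
   digit sequences: f 0 and the entry at position 0 carry no information. *)

(* f_(a_1) \o ... \o f_(a_n) for the word w = [:: a_1; ...; a_n] *)
Definition comp_word f w : R -> R := foldr (fun i g => f i \o g) id w.

Definition positive_word w := all (fun i => 0 < i)%N w.

Record decaying_gauss_like (d : R) f : Prop := DecayingGaussLike {
  dgl_maps : forall i, (0 < i)%N -> f i @` `[0, 1] `<=` `[0, 1] ;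
  dgl_C1 : forall i, (0 < i)%N -> C1_01 (f i) ;
  dgl_open_set : forall i j, (0 < i)%N -> (0 < j)%N -> i <> j ->
    f i @` `]0, 1[ `&` f j @` `]0, 1[ = set0 ;
  dgl_contraction : exists (q : nat) (rho : R),
    [/\ (0 < q)%N, 0 < rho, rho < 1 &
      forall w, size w = q -> positive_word w ->
      forall x, x \in `[0, 1] -> 0 < `|deriv01 (comp_word f w) x| <= rho] ;
  dgl_regularity : forall eps : R, 0 < eps ->
    exists C1 C2 : R, [/\ 0 < C1, 0 < C2 &
      forall i, (0 < i)%N -> exists xi lambda : R,
        (forall x, x \in `[0, 1] -> xi <= `|deriv01 (f i) x| <= lambda) /\
        [/\ C1 / i%:R `^ (d + eps) <= xi, xi <= lambda &
            lambda <= C2 / i%:R `^ (d - eps)]] ;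
  dgl_cover : \bigcup_(i in [set i | (0 < i)%N]) (f i @` `[0, 1]) = [set` `]0, 1]] ;
  dgl_order : forall i j, (0 < j)%N -> (j < i)%N ->
    forall x, x \in `[0, 1] -> f i x < f j x ;
  dgl_distortion : exists kappa : R, 1 <= kappa /\
    forall w, (0 < size w)%N -> positive_word w ->
    forall x y : R, x \in `[0, 1] -> y \in `[0, 1] ->
      `|deriv01 (comp_word f w) x| <= kappa * `|deriv01 (comp_word f w) y|
}.

(* The sequences (a_n)_(n >= 1) of positive integers with Pi(a) = x; setting
   a 0 = 0 makes the functions a correspond exactly to such sequences. *)
Definition codings f x : set (nat -> nat) := [set a |
  [/\ a 0%N = 0%N, forall n, (0 < n)%N -> (0 < a n)%N &
      comp_word f [seq a k | k <- iota 1 n] 1 @[n --> \oo] --> x]].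

Definition uniquely_coded f x := exists! a, codings f x a.

(* Meaningful for uniquely coded x only. *)
Definition digit f x : nat -> nat := xget (fun=> 0%N) (codings f x).

Definition Lambda f : set R := [set x |
  [/\ x \in `]0, 1[, uniquely_coded f x &
      forall n, (1 <= n)%N -> (digit f x n <= digit f x n.+1)%N]].

(* At n = 0 and n = 1 the quotient is 0 by convention, which does not affect
   the lower limit. *)
Definition E_set f (L : set R) (alpha : \bar R) (m : nat)
    (t : 'I_m.+1 -> R) : set R := [set x | L x /\
  limn_einf (fun n : nat =>
    (ln (\prod_(i < m.+1) (digit f x (n + i))%:R `^ t i) / ln n%:R)%:E)
  = alpha].

End gauss_like_systems.

Section hausdorff_dimension.
Context {R : realType}.
Local Open Scope ereal_scope.
Implicit Types (A : set R) (s delta : R).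

(* diam set0 = -oo *)
Definition diam A : \bar R := ereal_sup [set `|p.1 - p.2|%:E | p in A `*` A].

(* (diam A)^s, with value 0 on the empty set also when s = 0; 0^0 = 1 *)
Definition diam_pow s A : \bar R := if A == set0 then 0 else diam A `^ s.

Definition hausdorff_premeasure s delta A : \bar R :=
  ereal_inf [set \sum_(0 <= k <oo) diam_pow s (U k) | U in
    [set U : nat -> set R |
      A `<=` \bigcup_k U k /\ forall k, diam (U k) <= delta%:E]].

Definition hausdorff_measure s A : \bar R :=
  ereal_sup [set hausdorff_premeasure s delta A |
    delta in [set delta | (0 < delta)%R]].

Definition hausdorff_dim A : \bar R :=
  ereal_inf [set s%:E | s in [set s | (0 <= s)%R /\ hausdorff_measure s A = 0]].

End hausdorff_dimension.

(* Main.v *)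
Require Import Defs.
From mathcomp Require Import all_boot all_order all_algebra.
From mathcomp Require Import all_classical all_reals all_analysis.
From mathcomp Require Import ring lra zify.

Import Order.TTheory GRing.Theory Num.Theory.
Import numFieldNormedType.Exports.

Local Open Scope classical_set_scope.
Local Open Scope ring_scope.

(* By the mean value theorem each [f i] contracts by a factor between
   [C1 / i^(d + eps)] and [C2 / i^(d - eps)].  Write [b = alpha / Sigma].

   Upper bounds.  Monotone digits with [liminf = alpha] satisfy
   [a_n <= n^(b + eta)] infinitely often and [a_n >= n^(b - eta)] eventually.
   There are at most ['C(n + K, n)] nondecreasing words of length [n] with
   entries at most [K].  For [b < 1], [K = n^c] with [c < 1] gives
   subexponentially many cylinders, of superexponentially small diameter since
   the digits tend to infinity (or are eventually constant).  For [b >= 1] there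
   are about [n!^(b - 1)] cylinders of diameter about [n!^(-d b)].  For
   [alpha = +oo] the set [F] of the points with digits above [B] is covered by
   its images [f_i F], [i > B], and [\sum_(i > B) |f_i'|^s < 1 / 2] forces
   [H^s_delta F = 0].

   Lower bounds.  Take digits in windows [u_n + 2 j], [j < Q_n], with
   [u_n ~ 2 n^b] and [Q_n ~ n^(b - 1)], or [u_n = 2^(n + 1)] and [Q_n = 2^n]
   if [alpha = +oo].  Reading [j] off the mixed radix expansion of a point of
   [0, 1[ gives a map [G] with [|x - y| <= C |G x - G y|^s], and Lebesgue
   measure on [0, 1[ then bounds the [s]-dimensional measure of its image. *)

(** * Hausdorff measures on the line *)

(** For nondecreasing digits, [a_n^Sigma <= a_n^(t_0) ... a_(n+m)^(t_m) <= a_(n+m)^Sigma], so the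
    weights matter only through [Sigma]; this is the origin of [b]. Since [(n + 1)^b - n^b] is about
    [n^(b - 1)], monotonicity leaves about that many choices for the n-th digit, and each digit
    costs a factor [n^(- d b)] in diameter; hence the ratio [(b - 1) / (d b) = (alpha - Sigma) / (d
    alpha)].

    Two obstacles shape the proof. A lower limit bounds the digits from above only at infinitely
    many [n], which depend on the point. The upper bounds therefore use cylinders of all lengths
    [n >= N] at once and need summable estimates. For the lower bounds, neighbouring images may
    share an end point and each branch may preserve or reverse orientation, so points with different
    words need not be far apart. This makes their coding unique, as [Lambda] demands. *)

Section diameter.
Context {R : realType}.
Implicit Types (A B : set R) (s delta : R) (x y : R).

Lemma le_diam A x y : A x -> A y -> (`|x - y|%:E <= diam A)%E.
Proof. by move=> Ax Ay; apply: ereal_sup_ubound; exists (x, y). Qed.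

Lemma diam_le A (r : \bar R) :
  (forall x y, A x -> A y -> (`|x - y|%:E <= r)%E) -> (diam A <= r)%E.
Proof. by move=> Ar; apply: ge_ereal_sup => _ [[x y] [/= Ax Ay] <-]; exact: Ar. Qed.

Lemma diam_ge0 A : A !=set0 -> (0 <= diam A)%E.
Proof. by move=> [x Ax]; have := le_diam _ _ _ Ax Ax; rewrite subrr normr0. Qed.

Lemma diam_set0 : diam (set0 : set R) = -oo%E.
Proof.
rewrite /diam; have -> : (set0 `*` set0 : set (R * R)) = set0.
  by apply/seteqP; split=> // x [].
by rewrite image_set0 ereal_sup0.
Qed.

Lemma diam_pow_ge0 s A : (0 <= diam_pow s A)%E.
Proof. by rewrite /diam_pow; case: ifP => // _; exact: poweR_ge0. Qed.

Lemma diam_pow_set0 s : diam_pow s (set0 : set R) = 0%E.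
Proof. by rewrite /diam_pow eqxx. Qed.

Lemma diam_fin_num A delta : A !=set0 -> (diam A <= delta%:E)%E ->
  diam A \is a fin_num.
Proof. by move=> /diam_ge0 A0 Ad; rewrite ge0_fin_numE// (le_lt_trans Ad) ?ltry. Qed.

Lemma diam_powE s A delta : A !=set0 -> (diam A <= delta%:E)%E ->
  diam_pow s A = ((fine (diam A)) `^ s)%:E.
Proof.
move=> A0 Ad; rewrite /diam_pow ifF; last by apply/negbTE/set0P.
by rewrite -{1}(fineK (diam_fin_num _ _ A0 Ad)) poweR_EFin.
Qed.

Lemma diam_pow_le s A (r : R) : 0 <= s -> 0 <= r -> (diam A <= r%:E)%E ->
  (diam_pow s A <= (r `^ s)%:E)%E.
Proof.
move=> s0 r0 Ar; have [->|/set0P A0] := eqVneq A set0.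
  by rewrite diam_pow_set0 lee_fin powR_ge0.
have Ag0 : 0 <= fine (diam A) by rewrite fine_ge0// diam_ge0.
rewrite (diam_powE _ _ _ A0 Ar) lee_fin ge0_ler_powR ?nnegrE//.
by rewrite -lee_fin fineK// (diam_fin_num _ _ A0 Ar).
Qed.

End diameter.

Section hausdorff_premeasure.
Context {R : realType}.
Implicit Types (A B : set R) (s delta : R) (x y : R).
Local Open Scope ereal_scope.

Lemma hausdorff_premeasure_ge0 s delta A : 0 <= hausdorff_premeasure s delta A.
Proof.
apply: le_ereal_inf_tmp => _ [U _ <-]; apply: nneseries_ge0 => k _ _.
exact: diam_pow_ge0.
Qed.

Lemma le_hausdorff_premeasure s delta A B : A `<=` B ->
  hausdorff_premeasure s delta A <= hausdorff_premeasure s delta B.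
Proof.
move=> AB; apply: ereal_inf_le_tmp => _ [U [BU Ud] <-].
by exists U => //; split => //; exact: subset_trans BU.
Qed.

Lemma hausdorff_premeasure_le_delta s delta delta' A : (delta <= delta')%R ->
  hausdorff_premeasure s delta' A <= hausdorff_premeasure s delta A.
Proof.
move=> dd; apply: ereal_inf_le_tmp => _ [U [BU Ud] <-].
by exists U => //; split => // k; rewrite (le_trans (Ud k))// lee_fin.
Qed.

(* [hausdorff_premeasure s delta] is the outer measure generated by the cost
   [diam_pow s], extended by [+oo] to the sets of diameter above [delta]; to
   use the library's construction, every set is declared measurable. *)
Lemma hausdorff_premeasure_sigma_subadditive s delta :
  sigma_subadditive (hausdorff_premeasure s delta).
Proof.
pose T := g_sigma_algebraType [set: set R].
pose cost (A : set T) := if diam A <= delta%:E then diam_pow s A else +oo.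
have cost_ge0 A : 0 <= cost A.
  by rewrite /cost; case: ifP => // _; exact: diam_pow_ge0.
suff -> : hausdorff_premeasure s delta = mu_ext cost.
  by move=> F; exact: (@mu_ext_sigma_subadditive _ T R cost cost_ge0 F).
apply/funext => A; apply/eqP; rewrite eq_le; apply/andP; split.
  apply: le_ereal_inf_tmp => _ [U [mU AU] <-].
  have [Ud|] := pselect (forall k, diam (U k) <= delta%:E).
    apply: ereal_inf_lbound; exists U => //.
    by apply: eq_eseriesr => k _; rewrite /cost Ud.
  move=> /existsNP[k /negP Uk]; rewrite (eseries_pinfty _ _ (_ : cost (U k) = +oo)).
  - exact: leey.
  - by move=> n _; rewrite -ltNye (lt_le_trans _ (cost_ge0 _)).
  - by [].
  - by rewrite /cost (negbTE Uk).
apply: le_ereal_inf_tmp => _ [U [AU Ud] <-].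
apply: ereal_inf_lbound; exists U.
  by split => // k; exact: sub_sigma_algebra.
by apply: eq_eseriesr => k _; rewrite /cost Ud.
Qed.

Lemma nneseries_first (u : nat -> \bar R) : (forall k, 0 <= u k) ->
  (forall k, u k.+1 = 0) -> \sum_(0 <= k <oo) u k = u 0%N.
Proof.
move=> u0 u1; rewrite nneseries_recl//.
rewrite eseries_cond/= eseries0 ?adde0// => -[|k] //.
Qed.

Lemma hausdorff_premeasure_diam s delta A : diam A <= delta%:E ->
  hausdorff_premeasure s delta A <= diam_pow s A.
Proof.
move=> Ad; apply: ereal_inf_lbound; exists (fun k => if k is 0 then A else set0).
  split; first by move=> x Ax; exists 0%N.
  by case=> [//|k]; rewrite diam_set0 leNye.
rewrite nneseries_first// => k; first exact: diam_pow_ge0.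
exact: diam_pow_set0.
Qed.

Lemma hausdorff_premeasure_set0 s delta : hausdorff_premeasure s delta set0 = 0.
Proof.
apply/eqP; rewrite eq_le hausdorff_premeasure_ge0 andbT.
rewrite (le_trans (hausdorff_premeasure_diam _ _ _ _))// ?diam_set0 ?leNye//.
by rewrite diam_pow_set0.
Qed.

Lemma hausdorff_premeasureU s delta A B :
  hausdorff_premeasure s delta (A `|` B) <=
  hausdorff_premeasure s delta A + hausdorff_premeasure s delta B.
Proof.
pose F k := match k with 0 => A | 1 => B | _ => set0 end%N.
have -> : A `|` B = \bigcup_k F k.
  apply/seteqP; split=> [x [Ax|Bx]|x [[|[|k]] _ //= Fx]];
    by [exists 0%N|exists 1%N|left|right].
apply: (le_trans (hausdorff_premeasure_sigma_subadditive _ _ _)).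
rewrite (nneseries_split 0 2); last by move=> *; exact: hausdorff_premeasure_ge0.
rewrite add0n !big_nat_recr//= big_nil add0e eseries0 ?adde0//.
by case=> [//|[//|k]] _ _; exact: hausdorff_premeasure_set0.
Qed.

Lemma hausdorff_premeasure_bigcup_seq (I : eqType) (r : seq I) (F : I -> set R) s delta :
  hausdorff_premeasure s delta (\bigcup_(i in [set` r]) F i) <=
  \sum_(i <- r) hausdorff_premeasure s delta (F i).
Proof.
elim: r => [|i r ih].
  rewrite big_nil -(hausdorff_premeasure_set0 s delta).
  by apply: le_hausdorff_premeasure => x [].
rewrite big_cons.
apply: (le_trans (le_hausdorff_premeasure _ _ _
    (F i `|` \bigcup_(j in [set` r]) F j) _)).
  move=> x [j /=]; rewrite inE => /orP[/eqP->|jr Fx]; first by left.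
  by right; exists j.
exact: (le_trans (hausdorff_premeasureU _ _ _ _)) (leeD2l _ ih).
Qed.

Lemma hausdorff_premeasure_lipschitz s delta (L : R) (g : R -> R) A :
  (0 <= s)%R -> (0 < L)%R ->
  (forall x y, A x -> A y -> (`|g x - g y| <= L * `|x - y|)%R) ->
  hausdorff_premeasure s (L * delta)%R (g @` A) <=
  (L `^ s)%:E * hausdorff_premeasure s delta A.
Proof.
move=> s0 L0 gL.
have Ls0 : (0 < L `^ s)%R by rewrite powR_gt0.
rewrite -lee_pdivrMl//; apply: le_ereal_inf_tmp => _ [U [AU Ud] <-].
rewrite lee_pdivrMl// -nneseriesZl; last by move=> *; exact: diam_pow_ge0.
(* [g] is Lipschitz on [A] only, so the cover is cut down to [A] before it is pushed forward. *)
pose V k := g @` (U k `&` A).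
have VU k : diam (V k) <= L%:E * diam (U k).
  apply: diam_le => _ _ [x [Ux Ax] <-] [y [Uy Ay] <-].
  apply: (@le_trans _ _ (L * `|x - y|)%:E); first by rewrite lee_fin gL.
  by rewrite EFinM lee_pmul2l// le_diam.
apply: (@le_trans _ _ (\sum_(0 <= k <oo) diam_pow s (V k))).
  apply: ereal_inf_lbound; exists V => //; split.
    move=> _ [x Ax <-]; have [k _ Ukx] := AU _ Ax.
    by exists k => //; exists x.
  by move=> k; rewrite (le_trans (VU k))// EFinM lee_pmul2l// Ud.
apply: lee_nneseries => [k _ _|k _]; first exact: diam_pow_ge0.
have [->|/set0P V0] := eqVneq (V k) set0.
  by rewrite diam_pow_set0 mule_ge0 ?diam_pow_ge0// lee_fin ltW.
have U0 : U k !=set0 by case: V0 => _ [x [Ux _] _]; exists x.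
have Uf := diam_fin_num _ _ U0 (Ud k).
rewrite (diam_powE s _ _ U0 (Ud k)) -EFinM -powRM ?fine_ge0 ?diam_ge0 ?(ltW L0)//.
apply: diam_pow_le; rewrite ?mulr_ge0 ?fine_ge0 ?diam_ge0 ?(ltW L0)//.
by rewrite EFinM fineK.
Qed.

(** Finiteness is what later lets [h <= h / 2] force [h = 0]. The interval is cut into pieces of
    length [1 / N <= delta]; the extra piece of index [N] is there for the point 1. *)
Lemma hausdorff_premeasure_fin s delta A : (0 <= s)%R -> (0 < delta)%R ->
  A `<=` `[0%R, 1%R] -> hausdorff_premeasure s delta A < +oo.
Proof.
move=> s0 d0 A01; pose N := (Num.truncn (delta^-1)).+1.
have N0 : (0 < N%:R :> R)%R by rewrite ltr0n.
have dN : (N%:R^-1 <= delta)%R.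
  by rewrite -[leRHS]invrK lef_pV2 ?posrE ?invr_gt0// ltW// truncnS_gt.
pose J (k : nat) : set R := `[(k%:R / N%:R)%R, (k.+1%:R / N%:R)%R]%classic.
have Jd k : diam (J k) <= (N%:R^-1)%:E.
  apply: diam_le => x y; rewrite /J/= !in_itv/= => /andP[x1 x2] /andP[y1 y2].
  have E : (k.+1%:R / N%:R = k%:R / N%:R + N%:R^-1 :> R)%R.
    by rewrite -natr1 mulrDl mul1r.
  by rewrite lee_fin ler_norml; move: x2 y2; rewrite E => x2 y2; lra.
apply: (@le_lt_trans _ _ (\sum_(k <- iota 0 N.+1) diam_pow s (J k))); last first.
  apply: lte_sum_pinfty => k _.
  apply: (@le_lt_trans _ _ (N%:R^-1 `^ s)%:E); last exact: ltry.
  by apply: diam_pow_le; rewrite ?invr_ge0.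
apply: (@le_trans _ _ (\sum_(k <- iota 0 N.+1) hausdorff_premeasure s delta (J k))).
  apply: (le_trans (le_hausdorff_premeasure _ _ _ _ _)); last first.
    exact: hausdorff_premeasure_bigcup_seq.
  move=> x /A01; rewrite /= in_itv/= => /andP[x0 x1].
  have xN0 : (0 <= x * N%:R)%R by rewrite mulr_ge0// ltW.
  have tN : Num.truncn (x * N%:R) \in iota 0 N.+1.
    have xN : (x * N%:R <= N%:R)%R by rewrite ger_pMl.
    by rewrite mem_iota add0n ltnS (leq_trans (le_truncn xN))// natrK.
  exists (Num.truncn (x * N%:R)); first exact: tN.
  have /andP[t1 t2] := truncn_itv xN0.
  by rewrite /J/= in_itv/= ler_pdivrMr// ler_pdivlMr// t1 ltW.
apply: lee_sum => k _; apply: hausdorff_premeasure_diam.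
by rewrite (le_trans (Jd k)).
Qed.

End hausdorff_premeasure.

Section hausdorff_measure.
Context {R : realType}.
Implicit Types (A B : set R) (s delta : R) (x y : R).
Local Open Scope ereal_scope.

Lemma hausdorff_measure_eq0P s A : hausdorff_measure s A = 0 <->
  forall delta, (0 < delta)%R -> hausdorff_premeasure s delta A = 0.
Proof.
split=> [H0 delta d0|H].
  apply/eqP; rewrite eq_le hausdorff_premeasure_ge0 andbT -H0.
  by apply: ereal_sup_ubound; exists delta.
apply/eqP; rewrite eq_le; apply/andP; split.
  by apply: ge_ereal_sup => _ [delta /= d0 <-]; rewrite H.
apply: (@le_trans _ _ (hausdorff_premeasure s 1 A)).
  exact: hausdorff_premeasure_ge0.
by apply: ereal_sup_ubound; exists 1%R => //=.
Qed.

Lemma hausdorff_measure0_sub s A B : A `<=` B ->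
  hausdorff_measure s B = 0 -> hausdorff_measure s A = 0.
Proof.
move=> AB /hausdorff_measure_eq0P H; apply/hausdorff_measure_eq0P => delta d0.
apply/eqP; rewrite eq_le hausdorff_premeasure_ge0 andbT -(H _ d0).
exact: le_hausdorff_premeasure.
Qed.

Lemma hausdorff_measure0_bigcup s (F : nat -> set R) :
  (forall k, hausdorff_measure s (F k) = 0) ->
  hausdorff_measure s (\bigcup_k F k) = 0.
Proof.
move=> HF; apply/hausdorff_measure_eq0P => delta d0.
apply/eqP; rewrite eq_le hausdorff_premeasure_ge0 andbT.
rewrite (le_trans (hausdorff_premeasure_sigma_subadditive _ _ _))// eseries0//.
by move=> k _ _; move/hausdorff_measure_eq0P : (HF k) => ->.
Qed.

Lemma hausdorff_measure0_countable_bigcup s (I : countType) (F : I -> set R) :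
  (forall i, hausdorff_measure s (F i) = 0) ->
  hausdorff_measure s (\bigcup_i F i) = 0.
Proof.
move=> HF; pose G k := if unpickle k is Some i then F i else set0.
apply: (@hausdorff_measure0_sub _ _ (\bigcup_k G k)).
  by move=> x [i _ Fx]; exists (pickle i) => //; rewrite /G pickleK.
apply: hausdorff_measure0_bigcup => k; rewrite /G; case: unpickle => // .
by apply/hausdorff_measure_eq0P => *; exact: hausdorff_premeasure_set0.
Qed.

Lemma hausdorff_measure0_lipschitz s (L : R) (g : R -> R) A :
  (0 <= s)%R -> (0 < L)%R ->
  (forall x y, A x -> A y -> (`|g x - g y| <= L * `|x - y|)%R) ->
  hausdorff_measure s A = 0 -> hausdorff_measure s (g @` A) = 0.
Proof.
move=> s0 L0 gL /hausdorff_measure_eq0P H.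
apply/hausdorff_measure_eq0P => delta d0.
apply/eqP; rewrite eq_le hausdorff_premeasure_ge0 andbT.
have := @hausdorff_premeasure_lipschitz R s (delta / L) L g A s0 L0 gL.
have -> : (L * (delta / L) = delta)%R by field; rewrite gt_eqF.
by rewrite H ?divr_gt0// mule0.
Qed.

Lemma hausdorff_measure0_diam s A : (0 < s)%R -> diam A <= 0 ->
  hausdorff_measure s A = 0.
Proof.
move=> s0 A0; apply/hausdorff_measure_eq0P => delta d0.
apply/eqP; rewrite eq_le hausdorff_premeasure_ge0 andbT.
rewrite (le_trans (hausdorff_premeasure_diam _ _ _ _))//.
  by rewrite (le_trans A0)// lee_fin ltW.
have := diam_pow_le s A 0%R (ltW s0) (lexx _) A0.
by rewrite powR0// gt_eqF.
Qed.

(* The pull-back of a cover of [A] by [g] is a cover of [0, 1[ by sets of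
   diameter at most [C (diam U)^s], so the sums of the [(diam U)^s] are
   bounded below. *)
Lemma hausdorff_measure_gt0 s (C : R) (g : R -> R) A : (0 <= s)%R -> (0 < C)%R ->
  (forall x, x \in `[0%R, 1%R[ -> A (g x)) ->
  (forall x y, x \in `[0%R, 1%R[ -> y \in `[0%R, 1%R[ ->
    (`|x - y| <= C * `|g x - g y| `^ s)%R) ->
  hausdorff_measure s A != 0.
Proof.
move=> s0 C0 Ag gC; apply/eqP => /hausdorff_measure_eq0P /(_ 1%R ltr01) H.
(* The preimage of [U k] lies in an interval of length [2 C (diam (U k))^s], so every cover has sum
   at least [1 / (2 C)]; any smaller positive bound, such as [1 / (3 C)], is contradictory. *)
have : hausdorff_premeasure s 1 A < (((3 * C)^-1)%R)%:E.
  by rewrite H lte_fin invr_gt0 mulr_gt0.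
move=> /ereal_inf_lt[_ [U [AU Ud] <-]] Ulow.
pose r k : R := (C * fine (diam (U k)) `^ s)%R.
pose J k : set R := if pselect (exists2 x, x \in `[0%R, 1%R[ & U k (g x)) is left e
  then `[(projT1 (cid2 e) - r k)%R, (projT1 (cid2 e) + r k)%R]%classic else set0.
have r0 k : (0 <= r k)%R by rewrite mulr_ge0 ?powR_ge0// ltW.
have Jcover : `[0%R, 1%R[ `<=` \bigcup_k J k.
  move=> x x01; have [k _ Ux] := AU _ (Ag _ x01); exists k => //.
  rewrite /J; case: pselect => [e|[]]; last by exists x.
  case: (cid2 e) => /= y y01 Uy; rewrite /= in_itv/=.
  suff : (`|x - y| <= r k)%R by rewrite ler_norml => xy; apply/andP; split; lra.
  apply: (le_trans (gC _ _ x01 y01)); rewrite ler_pM2l// ge0_ler_powR ?nnegrE//.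
    by rewrite fine_ge0// diam_ge0//; exists (g x).
  have U0 : U k !=set0 by exists (g x).
  by rewrite -lee_fin fineK ?le_diam// (diam_fin_num _ _ U0 (Ud k)).
have mJ k : measurable (J k).
  by rewrite /J; case: pselect => // e; exact: measurable_itv.
have lJ k : lebesgue_measure (J k) <= (2 * C)%:E * diam_pow s (U k).
  rewrite /J; case: pselect => [e|_]; last first.
    by rewrite measure0 mule_ge0 ?diam_pow_ge0// lee_fin mulr_ge0// ltW.
  case: (cid2 e) => /= y y01 Uy.
  have U0 : U k !=set0 by exists (g y).
  rewrite (diam_powE _ _ _ U0 (Ud k)) lebesgue_measure_itv /= lte_fin.
  case: ifP => _; last by rewrite -EFinM lee_fin !mulr_ge0 ?powR_ge0// ltW.
  rewrite -EFinB -EFinM lee_fin le_eqVlt; apply/orP; left; apply/eqP.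
  by rewrite /r; ring.
have : (1 : \bar R) <= \sum_(0 <= k <oo) lebesgue_measure (J k).
  have <- : lebesgue_measure (`[0%R, 1%R[%classic : set R) = 1.
    by rewrite lebesgue_measure_itv/= lte_fin ltr01 sube0.
  exact: measure_sigma_subadditive.
apply/negP; rewrite -ltNge.
apply: (@le_lt_trans _ _ (\sum_(0 <= k <oo) (2 * C)%:E * diam_pow s (U k))).
  by apply: lee_nneseries => k *; [exact: measure_ge0|exact: lJ].
rewrite nneseriesZl; last by move=> *; exact: diam_pow_ge0.
have C2 : (0 < 2 * C)%R by lra.
rewrite -lte_pdivlMl// mule1 (lt_trans Ulow)// lte_fin ltf_pV2 ?posrE; lra.
Qed.

End hausdorff_measure.

Section hausdorff_dimension.
Context {R : realType}.
Implicit Types (A : set R) (s : R).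
Local Open Scope ereal_scope.

Lemma hausdorff_dim_le (s0 : R) A : (0 <= s0)%R ->
  (forall s, (s0 < s)%R -> hausdorff_measure s A = 0) ->
  hausdorff_dim A <= s0%:E.
Proof.
move=> s00 H; apply/lee_addgt0Pr => e e0; apply: ereal_inf_lbound.
exists (s0 + e)%R => //; split; first by rewrite addr_ge0// ltW.
by apply: H; rewrite ltrDl.
Qed.

Lemma hausdorff_dim_ge (s0 : R) A :
  (forall s, (0 <= s)%R -> (s < s0)%R -> hausdorff_measure s A != 0) ->
  s0%:E <= hausdorff_dim A.
Proof.
move=> H; apply: le_ereal_inf_tmp => _ [s [s0' Hs] <-].
by rewrite lee_fin leNgt; apply/negP => /(H _ s0'); rewrite Hs eqxx.
Qed.

Lemma hausdorff_dim_ge0 A : 0 <= hausdorff_dim A.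
Proof. by apply: hausdorff_dim_ge => s /le_lt_trans /[apply]; rewrite ltxx. Qed.

End hausdorff_dimension.

Set Implicit Arguments.
Unset Strict Implicit.
Unset Printing Implicit Defensive.

(** * Distortion and order of the branches *)

Section mean_value.
Context {R : realType}.
Implicit Types (g : R -> R) (x y : R).

Lemma slope01_near g x (e : R) : cvg (slope01 g x) -> 0 < e ->
  exists2 r : R, 0 < r & forall y, `|x - y| < r -> y != x -> y \in `[0, 1] ->
    `|deriv01 g x - (g y - g x) / (y - x)| < e.
Proof.
move=> /cvgrPdist_lt /(_ e) H e0.
have := H e0; rewrite /= /within/= /dnbhs/= => -[r r0 Hr].
by exists r => // y xy yx y01; exact: Hr.
Qed.

Lemma slope01_is_derive g x : x \in `]0, 1[ -> cvg (slope01 g x) ->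
  is_derive x 1 g (deriv01 g x).
Proof.
rewrite in_itv/= => /andP[x0 x1] gx.
suff gD : h^-1 *: (g (h *: 1 + x) - g x) @[h --> 0^'] --> deriv01 g x.
  apply: DeriveDef; last exact/cvg_lim.
  by apply/cvg_ex; exists (deriv01 g x).
apply/cvgrPdist_lt => e e0; have [r r0 Hr] := slope01_near gx e0.
(* Increments below [x] and [1 - x] stay in [0, 1], where the relative and the two-sided difference
   quotients agree. *)
pose r' := Num.min r (Num.min x (1 - x)).
have r'0 : 0 < r' by rewrite !lt_min r0 x0 subr_gt0 x1.
exists r' => //= h; rewrite /ball_/= sub0r normrN !lt_min => /and3P[hr hx hx1] h0.
rewrite scaler1 [h^-1 *: _]mulrC.
have := Hr (h + x); rewrite opprD addrCA subrr addr0 normrN addrK; apply => //.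
  by rewrite -subr_eq0 addrK.
move: hx hx1; rewrite !ltr_norml in_itv/= => /andP[? ?] /andP[? ?].
by apply/andP; split; lra.
Qed.

Lemma slope01_continuous g : (forall x, x \in `[0, 1] -> cvg (slope01 g x)) ->
  {within `[0, 1], continuous g}.
Proof.
move=> gD; apply/subspace_continuousP => x /= x01.
have [r r0 Hr] := slope01_near (gD _ x01) ltr01.
pose L := `|deriv01 g x| + 1.
have L0 : 0 < L by rewrite ltr_wpDl.
apply/cvgrPdist_lt => e e0.
exists (Num.min r (e / L)); first by rewrite /= lt_min r0 divr_gt0.
move=> y /=; rewrite lt_min => /andP[yr yL] y01.
have [->|yx] := eqVneq y x; first by rewrite subrr normr0.
have yx0 : 0 < `|y - x| by rewrite normr_gt0 subr_eq0.
have gL : `|(g y - g x) / (y - x)| < L.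
  rewrite /L -ltrBlDl; apply: le_lt_trans (Hr y yr yx y01).
  by rewrite distrC lerB_dist.
rewrite distrC; apply: (@lt_trans _ _ (L * `|y - x|)).
  by rewrite -ltr_pdivrMr// -normf_div.
by rewrite mulrC -ltr_pdivlMr// distrC.
Qed.

Lemma C1_01_MVT g x y : C1_01 g -> x \in `[0, 1] -> y \in `[0, 1] -> x < y ->
  exists2 c, c \in `[0, 1] & g y - g x = deriv01 g c * (y - x).
Proof.
move=> [gD _]; rewrite !in_itv/= => /andP[x0 x1] /andP[y0 y1] xy.
have [||c] := @MVT R g (deriv01 g) x y xy.
- move=> z; rewrite in_itv/= => /andP[xz zy]; apply: slope01_is_derive.
    by rewrite in_itv/=; apply/andP; split; lra.
  by apply: gD; rewrite in_itv/=; apply/andP; split; lra.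
- apply: continuous_subspaceW (slope01_continuous gD) => z /=.
  by rewrite !in_itv/= => /andP[? ?]; apply/andP; split; lra.
rewrite in_itv/= => /andP[xc cy] E; exists c => //.
by rewrite in_itv/=; apply/andP; split; lra.
Qed.

Lemma C1_01_bilipschitz g (xi lambda : R) x y : C1_01 g ->
  (forall z, z \in `[0, 1] -> xi <= `|deriv01 g z| <= lambda) ->
  x \in `[0, 1] -> y \in `[0, 1] ->
  xi * `|x - y| <= `|g x - g y| <= lambda * `|x - y|.
Proof.
move=> gC gd; wlog xy : x y / x < y.
  move=> wl x01 y01; case: (ltgtP x y) => [xy|yx|->]; first exact: wl.
    by rewrite distrC [`|g x - _|]distrC; exact: wl.
  by rewrite !subrr normr0 !mulr0 lexx.
move=> x01 y01; have [c c01 E] := C1_01_MVT gC x01 y01 xy.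
have /andP[lo hi] := gd _ c01.
by rewrite distrC [`|g x - _|]distrC E normrM !ler_wpM2r.
Qed.

End mean_value.

Section gauss_like.
Context {R : realType} {d : R} {f : nat -> R -> R}.
Hypothesis hf : decaying_gauss_like d f.
Implicit Types (i j k : nat) (x y p q : R) (w : seq nat).

Local Notation I01 := `[0, 1 : R].

Lemma dgl_mem i x : (0 < i)%N -> x \in I01 -> f i x \in I01.
Proof. by move=> i0 x01; apply: (dgl_maps hf i0); exists x. Qed.

Lemma dgl_continuous i : (0 < i)%N -> {within `[0, 1], continuous (f i)}.
Proof. by move=> i0; apply: slope01_continuous; have [] := dgl_C1 hf i0. Qed.

Lemma dgl_bilipschitz (eps : R) : 0 < eps ->
  exists C1 C2 : R, [/\ 0 < C1 <= 1, 1 <= C2 &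
    forall i x y, (0 < i)%N -> x \in I01 -> y \in I01 ->
      C1 / i%:R `^ (d + eps) * `|x - y| <= `|f i x - f i y| <=
      C2 / i%:R `^ (d - eps) * `|x - y|].
Proof.
move=> e0; have [C1 [C2 [C10 C20 H]]] := dgl_regularity hf e0.
exists (Num.min C1 1), (Num.max C2 1); split.
- by rewrite lt_min C10 ltr01/= ge_min lexx orbT.
- by rewrite le_max lexx orbT.
move=> i x y i0 x01 y01; have [xi [lambda [Hd [H1 _ H2]]]] := H i i0.
have /andP[lo hi] := C1_01_bilipschitz (dgl_C1 hf i0) Hd x01 y01.
have p0 s : 0 < i%:R `^ s :> R by rewrite powR_gt0// ltr0n.
apply/andP; split.
  apply: le_trans lo; rewrite ler_wpM2r//; apply: le_trans H1.
  by rewrite ler_pM2r ?invr_gt0// ge_min lexx.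
apply: le_trans hi _; rewrite ler_wpM2r//; apply: le_trans H2 _.
by rewrite ler_pM2r ?invr_gt0// le_max lexx.
Qed.

Lemma dgl_noncontracting i x y : (0 < i)%N -> x \in I01 -> y \in I01 ->
  x != y -> f i x != f i y.
Proof.
move=> i0 x01 y01 xy; have [C1 [C2 [/andP[C10 _] _ H]]] := dgl_bilipschitz ltr01.
have /andP[lo _] := H i x y i0 x01 y01.
rewrite -subr_eq0 -normr_gt0; apply: lt_le_trans lo.
by rewrite mulr_gt0 ?divr_gt0 ?powR_gt0 ?ltr0n// normr_gt0 subr_eq0.
Qed.

(** The lower bound on the derivative makes [f i] injective, and a continuous injection of an
    interval is strictly monotone. The orientation may vary with [i]. *)
Lemma dgl_mono i : (0 < i)%N ->
  {in I01 &, {homo f i : x y / x < y}} \/ {in I01 &, {homo f i : x y /~ x < y}}.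
Proof.
move=> i0; apply: itv_continuous_inj_mono; first exact: dgl_continuous.
move=> x y x01 y01 /eqP; apply: contraTeq.
exact: dgl_noncontracting.
Qed.

(* If [f j y > f i x] with [i < j], then [f i x] would be between [f j x] and
   [f j y], hence in the images of both maps. *)
Lemma dgl_image_le_interior i j x y : (0 < i)%N -> (i < j)%N ->
  x \in `]0, 1[ -> y \in `]0, 1[ -> f j y <= f i x.
Proof.
move=> i0 ij x01 y01; rewrite leNgt; apply/negP => lt1.
have j0 : (0 < j)%N by exact: leq_trans ij.
have sub01 z : z \in `]0, 1[ -> z \in I01.
  by rewrite !in_itv/= => /andP[? ?]; apply/andP; split; lra.
have lt2 := dgl_order hf i0 ij (sub01 _ x01).
pose a := Num.min x y; pose b := Num.max x y.
have ab : a <= b by rewrite ge_min le_max lexx.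
have a0 : 0 < a by move: x01 y01; rewrite /a !in_itv/= lt_min => /andP[-> _] /andP[->].
have b1 : b < 1 by move: x01 y01; rewrite /b !in_itv/= gt_max => /andP[_ ->] /andP[_ ->].
have cont : {within `[a, b], continuous (f j)}.
  apply: continuous_subspaceW (dgl_continuous j0) => z /=.
  by rewrite !in_itv/= => /andP[? ?]; apply/andP; split; lra.
have [|c] := @IVT R (f j) a b (f i x) ab cont.
  by rewrite /a /b; case: (ltP x y) => _; rewrite ge_min le_max (ltW lt1) (ltW lt2) ?orbT.
rewrite in_itv/= => /andP[ac cb] E.
have : (f i @` `]0, 1[ `&` f j @` `]0, 1[) (f i x).
  split; first by exists x.
  by exists c => //=; rewrite in_itv/=; apply/andP; split; lra.
rewrite (dgl_open_set hf i0 j0)// => /eqP.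
by rewrite ltn_eqF.
Qed.

(** The open set condition concerns open intervals only. Each point is moved towards 1/2, by at most
    [eta], into the interior; the Lipschitz bounds then limit the total error to
    [(L i + L j) eta <= e]. *)
Lemma dgl_image_le i j x y : (0 < i)%N -> (i < j)%N ->
  x \in I01 -> y \in I01 -> f j y <= f i x.
Proof.
move=> i0 ij x01 y01; have j0 : (0 < j)%N by exact: leq_trans ij.
have [C1 [C2 [_ C2ge H]]] := dgl_bilipschitz ltr01.
have HL k z z' : (0 < k)%N -> z \in I01 -> z' \in I01 ->
    `|f k z - f k z'| <= C2 / k%:R `^ (d - 1) * `|z - z'|.
  by move=> k0 z01 z'01; have /andP[] := H k z z' k0 z01 z'01.
pose L k := C2 / k%:R `^ (d - 1).
have L0 k : (0 < k)%N -> 0 < L k.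
  by move=> k0; rewrite divr_gt0 ?powR_gt0 ?ltr0n// (lt_le_trans ltr01).
apply/ler_addgt0Pl => e e0.
pose eta := Num.min 1 (e / (L i + L j)).
have eta0 : 0 < eta by rewrite lt_min ltr01 divr_gt0// addr_gt0 ?L0.
have eta1 : eta <= 1 by rewrite ge_min lexx.
have eL : (L i + L j) * eta <= e.
  by rewrite mulrC -ler_pdivlMr ?addr_gt0 ?L0// ge_min lexx orbT.
pose c z := z + eta * (1 / 2 - z).
have cP z : z \in I01 -> [/\ c z \in `]0, 1[, c z \in I01 & `|z - c z| <= eta].
  rewrite in_itv/= => /andP[z0 z1].
  have : 0 <= (1 - eta) * z by rewrite mulr_ge0// subr_ge0.
  have : 0 <= (1 - eta) * (1 - z) by rewrite mulr_ge0// subr_ge0.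
  rewrite /c => h1 h2; split.
  - by rewrite in_itv/=; apply/andP; split; nra.
  - by rewrite in_itv/=; apply/andP; split; nra.
  - by rewrite ler_norml; apply/andP; split; nra.
have [x1 x2 x3] := cP _ x01; have [y1 y2 y3] := cP _ y01.
have := dgl_image_le_interior i0 ij x1 y1.
have := HL _ _ _ i0 x01 x2; have := HL _ _ _ j0 y01 y2.
rewrite -/(L i) -/(L j) => h1 h2.
have := le_trans h1 (ler_wpM2l (ltW (L0 _ j0)) y3).
have := le_trans h2 (ler_wpM2l (ltW (L0 _ i0)) x3).
by rewrite !ler_norml => /andP[? ?] /andP[? ?] ?; lra.
Qed.

End gauss_like.

(** * Codings *)

Section limits_of_distances.
Context {R : realType}.
Implicit Types (u v : nat -> R) (x y D : R).

Lemma cvg_dist_le u v x y D n : u @ \oo --> x -> v @ \oo --> y ->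
  (forall N, (n <= N)%N -> `|u N - v N| <= D) -> `|x - y| <= D.
Proof.
move=> ux vy H; have uv : `|u N - v N| @[N --> \oo] --> `|x - y|.
  by apply: cvg_norm; exact: cvgB.
rewrite -(cvg_lim _ uv)//; apply: limr_le; first by apply/cvg_ex; exists `|x - y|.
by exists n.
Qed.

Lemma cvg_dist_ge u v x y D n : u @ \oo --> x -> v @ \oo --> y ->
  (forall N, (n <= N)%N -> D <= `|u N - v N|) -> D <= `|x - y|.
Proof.
move=> ux vy H; have uv : `|u N - v N| @[N --> \oo] --> `|x - y|.
  by apply: cvg_norm; exact: cvgB.
rewrite -(cvg_lim _ uv)//; apply: limr_ge; first by apply/cvg_ex; exists `|x - y|.
by exists n.
Qed.

Lemma cvg_itvcc u (a b x : R) n : u @ \oo --> x ->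
  (forall N, (n <= N)%N -> u N \in `[a, b]) -> x \in `[a, b].
Proof.
move=> ux H; have xE := cvg_lim (@Rhausdorff R) ux.
have cu : cvgn u by apply/cvg_ex; exists x.
rewrite in_itv/= -xE; apply/andP; split.
  by apply: limr_ge => //; exists n => // N /H; rewrite in_itv/= => /andP[].
by apply: limr_le => //; exists n => // N /H; rewrite in_itv/= => /andP[].
Qed.

End limits_of_distances.

Section digit_words.
Implicit Types (a b : nat -> nat) (m n : nat).

Definition codeword a n : seq nat := [seq a k | k <- iota 1 n].

(* The sequence of the entries of [a] after the [n]-th one, with the junk value
   [0] at position [0]. *)
Definition shift_code n a k := if k is k'.+1 then a (n + k'.+1)%N else 0%N.

Definition positive_code a := forall n, (0 < n)%N -> (0 < a n)%N.

Lemma size_codeword a n : size (codeword a n) = n.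
Proof. by rewrite size_map size_iota. Qed.

Lemma codeword_cat a m n : codeword a (m + n) = codeword a m ++ codeword (shift_code m a) n.
Proof.
rewrite /codeword iotaD map_cat; congr (_ ++ _).
rewrite [(1 + m)%N]addnC iotaDl -map_comp; apply/eq_in_map => k.
by rewrite mem_iota; case: k.
Qed.

Lemma codewordSl a n : codeword a n.+1 = a 1%N :: codeword (shift_code 1 a) n.
Proof. by rewrite -add1n codeword_cat. Qed.

Lemma eq_codeword a b n : (forall k, (0 < k <= n)%N -> a k = b k) ->
  codeword a n = codeword b n.
Proof.
move=> ab; apply/eq_in_map => k; rewrite mem_iota => /andP[k0 kn].
by apply: ab; rewrite k0 -ltnS.
Qed.

Lemma codeword_eq a b n k : codeword a n = codeword b n -> (0 < k <= n)%N -> a k = b k.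
Proof.
rewrite /codeword => /eq_in_map ab /andP[k0 kn]; apply: ab.
by rewrite mem_iota k0.
Qed.

Lemma positive_codeword a n : positive_code a -> positive_word (codeword a n).
Proof.
move=> a0; apply/allP => _ /mapP[k + ->]; rewrite mem_iota => /andP[k0 _].
exact: a0.
Qed.

Lemma positive_shift_code a n : positive_code a -> positive_code (shift_code n a).
Proof. by move=> a0 [//|k] _ /=; apply: a0; rewrite addnS. Qed.

End digit_words.

Section words.
Context {R : realType} {f : nat -> R -> R}.
Implicit Types (i j k m n N : nat) (x y p q : R) (w : seq nat) (a b : nat -> nat).
Local Notation I01 := `[0, 1 : R].

Hypothesis fmem : forall i x, (0 < i)%N -> x \in I01 -> f i x \in I01.

Lemma one_in01 : 1 \in I01. Proof. by rewrite in_itv/= ler01 lexx. Qed.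

Lemma comp_word_cat w1 w2 x : comp_word f (w1 ++ w2) x = comp_word f w1 (comp_word f w2 x).
Proof. by elim: w1 => //= i w1 ->. Qed.

Lemma comp_word_mem w x : positive_word w -> x \in I01 -> comp_word f w x \in I01.
Proof.
by move=> + x01; elim: w => //= i w ih /andP[i0 w0]; exact/fmem/ih.
Qed.

Lemma dist01_le1 x y : x \in I01 -> y \in I01 -> `|x - y| <= 1.
Proof.
rewrite !in_itv/= => /andP[? ?] /andP[? ?].
by rewrite ler_norml; apply/andP; split; lra.
Qed.

Section lipschitz_bounds.
Variable lam : nat -> R.
Hypothesis lam0 : forall i, (0 < i)%N -> 0 <= lam i.

Lemma prod_codeword a n : \prod_(i <- codeword a n) lam i = \prod_(1 <= k < n.+1) lam (a k).
Proof. by rewrite big_map /index_iota subSS subn0. Qed.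

Lemma prod_word_ge0 w : positive_word w -> 0 <= \prod_(i <- w) lam i.
Proof.
by move=> /allP w0; rewrite big_seq; apply: prodr_ge0 => i /w0; exact: lam0.
Qed.

Lemma comp_word_lower w x y :
  (forall i x y, (0 < i)%N -> x \in I01 -> y \in I01 ->
    lam i * `|x - y| <= `|f i x - f i y|) ->
  positive_word w -> x \in I01 -> y \in I01 ->
  (\prod_(i <- w) lam i) * `|x - y| <= `|comp_word f w x - comp_word f w y|.
Proof.
move=> flo + x01 y01; elim: w => [|i w ih] /=; first by rewrite big_nil mul1r.
move=> /andP[i0 w0]; rewrite big_cons -mulrA.
apply: le_trans (flo _ _ _ i0 (comp_word_mem w0 x01) (comp_word_mem w0 y01)).
by rewrite ler_wpM2l ?lam0// ih.
Qed.

Hypothesis flam : forall i x y, (0 < i)%N -> x \in I01 -> y \in I01 ->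
  `|f i x - f i y| <= lam i * `|x - y|.

Lemma comp_word_upper w x y : positive_word w -> x \in I01 -> y \in I01 ->
  `|comp_word f w x - comp_word f w y| <= (\prod_(i <- w) lam i) * `|x - y|.
Proof.
move=> + x01 y01; elim: w => [|i w ih] /=; first by rewrite big_nil mul1r.
move=> /andP[i0 w0]; rewrite big_cons -mulrA.
apply: le_trans (flam i0 (comp_word_mem w0 x01) (comp_word_mem w0 y01)) _.
by rewrite ler_wpM2l ?lam0// ih.
Qed.

(** Once the common prefix is peeled off, both inner values lie in [0, 1]. Allowing [N] and [N'] to
    differ gives the Cauchy property of a single coding as well as the distance between two. *)
Lemma comp_codeword_dist a b n N N' : positive_code a -> positive_code b ->
  codeword a n = codeword b n -> (n <= N)%N -> (n <= N')%N ->
  `|comp_word f (codeword a N) 1 - comp_word f (codeword b N') 1| <=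
    \prod_(1 <= k < n.+1) lam (a k).
Proof.
move=> a0 b0 ab nN nN'; rewrite -(subnKC nN) -(subnKC nN') !codeword_cat -ab.
rewrite !comp_word_cat -prod_codeword.
have aw := positive_codeword n a0.
have ap := positive_codeword (N - n) (positive_shift_code n a0).
have bp := positive_codeword (N' - n) (positive_shift_code n b0).
apply: (le_trans (comp_word_upper aw (comp_word_mem ap one_in01) (comp_word_mem bp one_in01))).
by rewrite ler_piMr ?prod_word_ge0// dist01_le1// comp_word_mem// one_in01.
Qed.

Lemma codings_dist a b n x y : codings f x a -> codings f y b ->
  codeword a n = codeword b n -> `|x - y| <= \prod_(1 <= k < n.+1) lam (a k).
Proof.
move=> [_ a0 ax] [_ b0 bx] ab; apply: (cvg_dist_le (n := n) ax bx) => N nN.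
exact: comp_codeword_dist.
Qed.

Lemma codings_exist a : a 0%N = 0%N -> positive_code a ->
  (forall e : R, 0 < e -> exists n, \prod_(1 <= k < n.+1) lam (a k) < e) ->
  exists x, codings f x a.
Proof.
move=> a00 a0 Ha; pose z N := comp_word f (codeword a N) 1.
have : cvgn z.
  apply/cauchy_cvgP/cauchy_exP => e e0; have [n an] := Ha _ e0.
  exists (z n); exists n => // N /= nN; rewrite /ball/=.
  exact: le_lt_trans (comp_codeword_dist a0 a0 erefl (leqnn n) nN) an.
by move=> /cvg_ex[x zx]; exists x; split.
Qed.

Lemma codings_mem a x : codings f x a -> x \in I01.
Proof.
move=> [_ a0 ax]; apply: (cvg_itvcc (n := 0) ax) => N _.
by apply: comp_word_mem one_in01; exact: positive_codeword.
Qed.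

(** The map of the prefix is Lipschitz, hence commutes with the limit that defines the point coded
    by the tail. *)
Lemma codings_unshift a n x y : codings f x a -> codings f y (shift_code n a) ->
  x = comp_word f (codeword a n) y.
Proof.
move=> [_ a0 ax] ya; have y01 := codings_mem ya; case: ya => _ a0' ay.
have aw := positive_codeword n a0.
pose P := \prod_(i <- codeword a n) lam i.
apply/eqP; rewrite eq_sym -subr_eq0 -normr_le0; apply/ler_addgt0Pl => e e0; rewrite addr0.
(* The ratios are only known to be nonnegative here, so 1 is added before dividing. *)
have P0 : 0 < P + 1 by rewrite ltr_wpDl// prod_word_ge0.
have /cvgrPdist_le /(_ (e / (P + 1))) := ay; case; first by rewrite divr_gt0.
move=> n1 _ H1.
apply: (@cvg_dist_le _ (fun=> comp_word f (codeword a n) y) _ _ _ _ (n + n1)%N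
  (@cvg_cst _ _ _ _ _) ax) => N nN.
have nN' : (n <= N)%N by exact: leq_trans (leq_addr _ _) nN.
rewrite -/(codeword a N) -(subnKC nN') codeword_cat comp_word_cat.
have ap := positive_codeword (N - n) a0'.
apply: (le_trans (comp_word_upper aw y01 (comp_word_mem ap one_in01))).
rewrite -/P; have h := H1 (N - n)%N.
apply: (@le_trans _ _ ((P + 1) * (e / (P + 1)))).
  apply: ler_pM => //; first exact: prod_word_ge0.
    by rewrite lerDl.
  by apply: h; rewrite /= leq_subRL.
by rewrite mulrC divfK ?gt_eqF.
Qed.

End lipschitz_bounds.

End words.

(** * Real estimates *)

Section powR_facts.
Context {R : realType}.
Implicit Types (A p x : R) (n N : nat).

Lemma powR_nat_eventually_ge A p : 0 < p ->
  exists N, forall n, (N <= n)%N -> A <= n%:R `^ p.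
Proof.
move=> p0; pose B : R := Num.max A 1.
have B0 : 0 < B by rewrite lt_max ltr01 orbT.
exists (Num.truncn (B `^ p^-1)).+1 => n nN.
have Bn : B `^ p^-1 <= n%:R.
  by apply: (le_trans (ltW (truncnS_gt _))); rewrite ler_nat.
apply: (@le_trans _ _ B); first by rewrite le_max lexx.
have -> : B = (B `^ p^-1) `^ p by rewrite -powRrM mulVf ?gt_eqF// powRr1// ltW.
by rewrite ge0_ler_powR ?nnegrE ?powR_ge0 ?(ltW p0).
Qed.

Lemma nat_powR_ge1 n p : (0 < n)%N -> 0 <= p -> 1 <= n%:R `^ p :> R.
Proof.
move=> n0 p0; have n1 : 1 <= n%:R :> R by rewrite ler1n.
by have := ler_powR n1 p0; rewrite powRr0.
Qed.

(** Weak form of Stirling's formula, by induction through [(1 + 1/n)^n <= e]. It trades [n!] for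
    powers of [n] when words are weighed against diameters. *)
Lemma expn_self_le_fact n : n%:R ^+ n <= expR 1 ^+ n * n`!%:R :> R.
Proof.
elim: n => [|n ih]; first by rewrite !expr0 fact0 mulr1.
have [->|n0] := posnP n.
  by rewrite !expr1 factS fact0 muln1 mulr1 (le_trans _ (expR_ge1Dx 1))// lerDl.
have n0' : 0 < n%:R :> R by rewrite ltr0n.
rewrite exprS factS natrM [expR 1 ^+ _]exprS.
rewrite [leRHS](_ : _ = n.+1%:R * (expR 1 * (expR 1 ^+ n * n`!%:R))); last by ring.
rewrite ler_pM2l ?ltr0n//.
have -> : n.+1%:R = (1 + n%:R^-1) * n%:R :> R.
  by rewrite mulrDl mul1r mulVf ?gt_eqF// natr1.
rewrite exprMn; apply: ler_pM => //; rewrite ?exprn_ge0//.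
apply: (@le_trans _ _ (expR n%:R^-1 ^+ n)).
  by rewrite lerXn2r ?nnegrE ?expR_ge0 ?expR_ge1Dx// addr_ge0// invr_ge0.
by rewrite -expRM_natl mulfV// gt_eqF.
Qed.

(* Integral comparison, through [1 + t <= exp t]. *)
Lemma powR_telescope n p : 0 < p ->
  (n.+2%:R `^ (1 + p))^-1 <= (n.+1%:R `^ p)^-1 / p - (n.+2%:R `^ p)^-1 / p :> R.
Proof.
move=> p0; set x : R := n.+1%:R; set y : R := n.+2%:R.
have x0 : 0 < x by rewrite ltr0n.
have y0 : 0 < y by rewrite ltr0n.
have yE : y = x + 1 by rewrite /y /x -natr1.
have yp0 : 0 < y `^ p by rewrite powR_gt0.
have xp0 : 0 < x `^ p by rewrite powR_gt0.
rewrite powRD ?powRr1 ?(ltW y0)//; last by rewrite (gt_eqF y0) implybT.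
have yx : expR y^-1 <= y / x.
  have := expR_ge1Dx (- y^-1); rewrite expRN -[leRHS]div1r.
  have -> : 1 - y^-1 = x / y by rewrite yE; field; apply/eqP => ?; lra.
  rewrite ler_pdivlMr ?expR_gt0// => h.
  rewrite ler_pdivlMr//.
  have -> : expR y^-1 * x = x / y * expR y^-1 * y by field; rewrite gt_eqF.
  by rewrite -[leRHS]mul1r ler_pM2r.
have key : 1 + p / y <= y `^ p / x `^ p.
  have -> : y `^ p / x `^ p = (y / x) `^ p.
    have E : (y / x) `^ p * x `^ p = y `^ p.
      by rewrite -(powRM p (divr_ge0 (ltW y0) (ltW x0)) (ltW x0)) divfK ?gt_eqF.
    by rewrite -E mulfK ?gt_eqF.
  apply: le_trans (expR_ge1Dx _) _; rewrite mulrC expRM.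
  by rewrite ge0_ler_powR ?nnegrE ?expR_ge0 ?(ltW p0)// divr_ge0 ?(ltW x0) ?(ltW y0).
rewrite -mulrBl ler_pdivlMr// -(ler_pM2r yp0).
have -> : ((x `^ p)^-1 - (y `^ p)^-1) * y `^ p = y `^ p / x `^ p - 1.
  by field; rewrite !gt_eqF.
have -> : (y * y `^ p)^-1 * p * y `^ p = p / y by field; rewrite !gt_eqF.
by rewrite lerBrDl.
Qed.

Lemma sum_le_telescope (u v : nat -> R) N : (forall n, u n <= v n - v n.+1) ->
  \sum_(0 <= i < N) u i <= v 0%N - v N.
Proof.
move=> uv; elim: N => [|N ih]; first by rewrite big_geq// subrr.
by rewrite big_nat_recr//= (le_trans (lerD ih (uv N)))// addrA subrK.
Qed.

Lemma sum_powR_telescope N B p : 0 < p ->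
  \sum_(0 <= i < N) ((B + i).+2%:R `^ (1 + p))^-1 <= (B.+1%:R `^ p)^-1 / p :> R.
Proof.
move=> p0; pose v i : R := ((B + i).+1%:R `^ p)^-1 / p.
have v0 : 0 <= v N by rewrite divr_ge0 ?invr_ge0 ?powR_ge0 ?(ltW p0).
have -> : (B.+1%:R `^ p)^-1 / p = v 0%N by rewrite /v addn0.
apply: le_trans (sum_le_telescope (v := v) _ _) _; last by rewrite gerBl.
by move=> n; rewrite /v addnS; exact: powR_telescope.
Qed.

Lemma geometric_half_small (K r : R) : 0 < r ->
  exists N, forall n, (N <= n)%N -> K * 2^-1 ^+ n < r.
Proof.
move=> r0; have h : `|2^-1 : R| < 1 by rewrite ger0_norm ?invr_ge0//; lra.
have /cvgrPdist_lt /(_ r r0) [N _ HN] := @cvg_geometric R K _ h.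
exists N => n /HN /=; rewrite sub0r normrN; apply: le_lt_trans.
exact: ler_norm.
Qed.

Lemma powR_expn x p n : 0 <= x -> (x ^+ n) `^ p = (x `^ p) ^+ n.
Proof.
move=> x0; elim: n => [|n ih]; first by rewrite !expr0 powR1.
by rewrite !exprS powRM ?exprn_ge0// ih.
Qed.

(** Digit estimates hold only beyond some index [M]. Each earlier factor costs at most [W], so the
    loss [W^M] does not depend on [n]. *)
Lemma prod_le_tail (l r : nat -> R) (W : R) M n : 1 <= W ->
  (forall k, (0 < k)%N -> 0 <= l k) -> (forall k, (0 < k)%N -> 0 <= r k) ->
  (forall k, (0 < k <= M)%N -> l k <= W * r k) ->
  (forall k, (M < k)%N -> l k <= r k) ->
  \prod_(1 <= k < n.+1) l k <= W ^+ M * \prod_(1 <= k < n.+1) r k.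
Proof.
move=> W1 l0 r0 lW lr; have W0 : 0 < W by exact: lt_le_trans W1.
have prod_ge0 (u : nat -> R) m : (forall k, (0 < k)%N -> 0 <= u k) ->
    0 <= \prod_(1 <= k < m.+1) u k.
  by move=> u0; rewrite big_nat; apply: prodr_ge0 => k /andP[k0 _]; exact: u0.
apply: (@le_trans _ _ (W ^+ minn n M * \prod_(1 <= k < n.+1) r k)); last first.
  by rewrite ler_wpM2r ?prod_ge0// ler_weXn2l// geq_minr.
elim: n => [|n ih]; first by rewrite !big_geq// min0n expr0 mulr1.
rewrite ![\prod_(1 <= k < n.+2) _]big_nat_recr//=; have [nM|Mn] := ltnP n M.
  have h : l n.+1 <= W * r n.+1 by apply: lW.
  apply: (le_trans (ler_pM (prod_ge0 _ _ l0) (l0 n.+1 isT) ih h)).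
  rewrite (minn_idPl (ltnW nM)) (minn_idPl nM) exprSr.
  by rewrite le_eqVlt; apply/orP; left; apply/eqP; ring.
have h : l n.+1 <= r n.+1 by exact: lr.
apply: (le_trans (ler_pM (prod_ge0 _ _ l0) (l0 n.+1 isT) ih h)).
by rewrite (minn_idPr Mn) (minn_idPr (leqW Mn)) mulrA.
Qed.

Lemma ffact_le_exp n k : (n ^_ k <= n ^ k)%N.
Proof.
by elim: k => [|k ih]; rewrite ?ffactn0// ffactnSr expnSr leq_mul// leq_subr.
Qed.

Lemma bin_le_exp n k : ('C(n, k) <= n ^ k)%N.
Proof.
apply: leq_trans (ffact_le_exp n k); rewrite -bin_ffact.
by rewrite leq_pmulr// fact_gt0.
Qed.

(** With [k <= n^c], the binomial is at most [(2 n)^k], and [log (2 n) <= (1 + 1/p) n^p]. As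
    [c + 2 p = 1], one factor [n^p] pays for the logarithm and the other for the constant
    [1 + 1/p]. *)
Lemma bin_truncn_powR_le_expR (c : R) : 0 <= c -> c < 1 ->
  exists n0, forall n, (n0 <= n)%N ->
    'C(n + Num.truncn (n%:R `^ c : R), n)%:R <= expR 1 ^+ n :> R.
Proof.
move=> c0 c1; pose p := (1 - c) / 2; have p0 : 0 < p by rewrite /p; lra.
have [n0 Hn0] := powR_nat_eventually_ge (1 + p^-1) p0.
exists (maxn 1 n0) => n; rewrite geq_max => /andP[n1 /Hn0 np].
set X : R := n%:R; set k := Num.truncn _.
have X0 : 0 < X by rewrite ltr0n.
have X1 : 1 <= X by rewrite ler1n.
have kX : k%:R <= X `^ c by rewrite truncn_le powR_ge0.
have kn : (k <= n)%N.
  by rewrite -(ler_nat R) (le_trans kX)// -[leRHS]powRr1 ?(ltW X0)// ler_powR// ltW.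
have ->: 'C(n + k, n) = 'C(n + k, k) by rewrite -[LHS]bin_sub ?leq_addr// addKn.
apply: (@le_trans _ _ ((2 * X) ^+ k)).
  apply: (@le_trans _ _ ((n + k)%:R ^+ k)); first by rewrite -natrX ler_nat bin_le_exp.
  rewrite lerXn2r ?nnegrE ?mulr_ge0 ?(ltW X0)//.
  by rewrite /X -natrM ler_nat mul2n -addnn leq_add2l.
have X2 : 2 * X <= expR (X `^ p * (1 + p^-1)).
  rewrite mulrDr mulr1 expRD; apply: ler_pM => //; rewrite ?(ltW X0)//.
    apply: le_trans (expR_ge1Dx _); rewrite lerD2l.
    exact: nat_powR_ge1 n1 (ltW p0).
  rewrite expRM; apply: (@le_trans _ _ ((X `^ p) `^ p^-1)).
    by rewrite -powRrM mulfV ?gt_eqF// powRr1// ltW.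
  rewrite ge0_ler_powR ?nnegrE ?powR_ge0 ?expR_ge0 ?invr_ge0 ?(ltW p0)//.
  by apply: le_trans (expR_ge1Dx _); rewrite lerDr.
apply: (@le_trans _ _ (expR (X `^ p * (1 + p^-1)) ^+ k)).
  by rewrite lerXn2r ?nnegrE ?expR_ge0// mulr_ge0// ltW.
rewrite -!expRM_natl ler_expR mulr1 -/X.
apply: (@le_trans _ _ (X `^ c * (X `^ p * X `^ p))).
  apply: ler_pM => //; first by rewrite mulr_ge0 ?powR_ge0// addr_ge0 ?invr_ge0 ?(ltW p0).
  by rewrite ler_wpM2l ?powR_ge0.
rewrite -!powRD ?(gt_eqF X0) ?implybT//.
have -> : c + (p + p) = 1 by rewrite /p; field.
by rewrite powRr1 // ltW.
Qed.

End powR_facts.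

(** * Upper bounds *)

Section upper_bounds.
Context {R : realType} {f : nat -> R -> R}.
Implicit Types (i j k m n N B : nat) (x y : R) (w : seq nat) (a b : nat -> nat).
Local Notation I01 := `[0, 1 : R].

Hypothesis fmem : forall i x, (0 < i)%N -> x \in I01 -> f i x \in I01.

Variables (C e : R).
Hypothesis (C1 : 1 <= C) (e0 : 0 < e).
Let lam i : R := C / i%:R `^ e.
Hypothesis flam : forall i x y, (0 < i)%N -> x \in I01 -> y \in I01 ->
  `|f i x - f i y| <= lam i * `|x - y|.

Let C0 : 0 < C. Proof. exact: lt_le_trans C1. Qed.

Let lam_gt0 i : (0 < i)%N -> 0 < lam i.
Proof. by move=> i0; rewrite divr_gt0// powR_gt0// ltr0n. Qed.

Let lam_ge0 i : (0 < i)%N -> 0 <= lam i.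
Proof. by move=> i0; rewrite ltW// lam_gt0. Qed.

Let lam_leC i : (0 < i)%N -> lam i <= C.
Proof.
move=> i0; rewrite ler_pdivrMr ?powR_gt0 ?ltr0n// ler_peMr ?(ltW C0)//.
by rewrite nat_powR_ge1// ltW.
Qed.

Let lam_small (theta : R) : 0 < theta ->
  exists B, forall i, (0 < i)%N -> (B <= i)%N -> lam i <= theta.
Proof.
move=> t0; have [B HB] := @powR_nat_eventually_ge R (C / theta) _ e0.
exists B => i i0 /HB; rewrite ler_pdivrMr// => h.
by rewrite /lam ler_pdivrMr ?powR_gt0 ?ltr0n// mulrC.
Qed.

Let prod_lam_le (theta : R) B M a n : 0 < theta -> theta <= 1 ->
  (forall i, (0 < i)%N -> (B <= i)%N -> lam i <= theta) ->
  positive_code a -> (forall k, (M < k)%N -> (B <= a k)%N) ->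
  \prod_(1 <= k < n.+1) lam (a k) <= (C / theta) ^+ M * theta ^+ n.
Proof.
move=> t0 t1 HB a0 aB.
have Ct1 : 1 <= C / theta by rewrite ler_pdivlMr// mul1r (le_trans t1).
have -> : theta ^+ n = \prod_(1 <= k < n.+1) theta.
  by rewrite big_const_nat subSS subn0 iter_mulr_1.
apply: prod_le_tail => // [k k0|k k0|k /andP[k0 _]|k Mk].
- exact/lam_ge0/a0.
- exact: ltW.
- by rewrite divfK ?gt_eqF//; exact/lam_leC/a0.
- by apply: HB; [exact/a0/(leq_trans _ Mk)|exact: aB].
Qed.

Lemma codings_exist_of_large B M a : 
  (forall i, (0 < i)%N -> (B <= i)%N -> lam i <= 2^-1) ->
  a 0%N = 0%N -> positive_code a -> (forall k, (M < k)%N -> (B <= a k)%N) ->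
  exists x, codings f x a.
Proof.
move=> HB a00 a0 aB.
apply: (codings_exist fmem lam_ge0 flam a00 a0) => r r0.
have h0 : 0 < 2^-1 :> R by [].
have h1 : 2^-1 <= 1 :> R by lra.
have [n Hn] := geometric_half_small ((C / 2^-1) ^+ M) r0; exists n.
by apply: le_lt_trans (Hn n (leqnn n)); exact: prod_lam_le HB a0 aB.
Qed.

(** The self-covering argument runs on the premeasure, which is finite on subsets of [0, 1]; the
    measure might be infinite, and then [h <= h / 2] would say nothing. *)
Lemma hausdorff_measure0_large_digits s B : 0 < s ->
  (forall i, (B < i)%N -> lam i <= 2^-1) ->
  (forall N, \sum_(0 <= i < N) lam (B + i).+1 `^ s <= 2^-1) ->
  hausdorff_measure s
    [set x | exists2 a, codings f x a & forall k, (0 < k)%N -> (B < a k)%N] = 0%E.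
Proof.
move=> s0 HB HS; set F := [set x | _].
apply/hausdorff_measure_eq0P => delta d0; set h := hausdorff_premeasure _ _ _.
have h0 : (0 <= h)%E by exact: hausdorff_premeasure_ge0.
have F01 : F `<=` `[0, 1] by move=> x [a xa _]; exact: codings_mem xa.
have hfin : h \is a fin_num.
  by rewrite ge0_fin_numE// hausdorff_premeasure_fin// ltW.
suff : (h <= (2^-1)%:E * h)%E.
  rewrite -(fineK hfin) -EFinM lee_fin => hh.
  have h0' : 0 <= fine h by rewrite fine_ge0.
  by congr EFin; lra.
have Fsub : F `<=` \bigcup_k (f (B + k).+1 @` F).
  move=> x [a xa aB]; have [a00 a0 _] := xa.
  (* The tail of a coding must itself code a point of [F]; it converges because digits above [B]
     contract by at least 1/2. *)
  have [||||y ya] := @codings_exist_of_large B.+1 0 (shift_code 1 a).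
  - by move=> i _; exact: HB.
  - by [].
  - exact: positive_shift_code.
  - by move=> [//|k] _; exact: aB.
  exists (a 1 - B.+1)%N => //; exists y.
    by exists (shift_code 1 a) => // -[//|k] _; exact: aB.
  have -> : (B + (a 1 - B.+1)).+1 = a 1 by have := aB 1 isT; lia.
  exact/esym/(codings_unshift fmem lam_ge0 flam xa ya).
apply: (le_trans (le_hausdorff_premeasure _ _ _ _ Fsub)).
apply: (le_trans (hausdorff_premeasure_sigma_subadditive _ _ _)).
apply: (@le_trans _ _ (\sum_(0 <= k <oo) (fine h)%:E * (lam (B + k).+1 `^ s)%:E)%E).
  apply: lee_nneseries => [k _ _|k _]; first exact: hausdorff_premeasure_ge0.
  have l0 := lam_gt0 (ltn0Sn (B + k)).
  (* Ratios at most 1 keep the images of pieces of diameter at most [delta] below [delta], so the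
     same premeasure stands on both sides. *)
  have l1 : lam (B + k).+1 <= 1 by rewrite (le_trans (HB _ _)) ?ltnS ?leq_addr//; lra.
  rewrite fineK// muleC; apply: le_trans (hausdorff_premeasure_lipschitz _ delta _ _ _ (ltW s0) l0 _).
    by apply: hausdorff_premeasure_le_delta; rewrite ler_piMl// ltW.
  by move=> x y /F01 x01 /F01 y01; exact: flam.
rewrite nneseriesZl; last by move=> k _; rewrite lee_fin powR_ge0.
rewrite fineK// muleC lee_wpmul2r//; apply: lime_le.
  by apply: is_cvg_nneseries => k _ _; rewrite lee_fin powR_ge0.
by apply: nearW => N; rewrite sumEFin lee_fin.
Qed.

(** Behind a suitable prefix all digits exceed [B], so the set is covered by countably many
    Lipschitz images of a null set, one for each prefix. *)
Lemma hausdorff_measure0_digits_infty s : 0 < s -> 1 < s * e ->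
  hausdorff_measure s [set x | exists2 a, codings f x a &
    forall B, exists M, forall k, (M < k)%N -> (B <= a k)%N] = 0%E.
Proof.
move=> s0 se; pose p := s * e - 1; have p0 : 0 < p by rewrite subr_gt0.
(* [B1] makes the ratios at most 1/2, and [B2] makes the tail bound [C^s B^(-p) / p] at most 1/2. *)
have [B1 HB1] := @lam_small 2^-1 (ltac:(by [])).
have [B2 HB2] := @powR_nat_eventually_ge R (C `^ s * 2 / p) _ p0.
pose B := maxn B1 B2.+1.
have HB i : (B < i)%N -> lam i <= 2^-1.
  move=> Bi; apply: HB1; first exact: leq_trans Bi.
  by rewrite (leq_trans _ (ltnW Bi))// leq_maxl.
have HS N : \sum_(0 <= i < N) lam (B + i).+1 `^ s <= 2^-1.
  have B0 : (0 < B)%N by rewrite leq_max orbT.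
  have lamE i : lam i.+1 `^ s = C `^ s * (i.+1%:R `^ (1 + p))^-1.
    rewrite /lam powRM ?invr_ge0 ?powR_ge0 ?(ltW C0)//; congr (_ * _).
    rewrite -powRN -powRrM /p addrCA subrr addr0 -powRN.
    by congr (_ `^ _); ring.
  (* The telescoping bound starts at its parameter plus 2, the digits at [B + 1]; hence [B.-1]. *)
  have := sum_powR_telescope N B.-1 p0; rewrite (prednK B0) => hS.
  apply: (@le_trans _ _ (C `^ s * ((B%:R `^ p)^-1 / p))).
    apply: (@le_trans _ _ (C `^ s * \sum_(0 <= i < N) ((B.-1 + i).+2%:R `^ (1 + p))^-1)).
      rewrite mulr_sumr le_eqVlt; apply/orP; left; apply/eqP.
      apply: eq_bigr => i _; rewrite lamE -[in RHS]addSn (prednK B0).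
      by [].
    by rewrite ler_wpM2l// powR_ge0.
  have Bp : 0 < B%:R `^ p :> R by rewrite powR_gt0// ltr0n.
  have := HB2 B (leq_trans (leqnSn _) (leq_maxr _ _)).
  rewrite ler_pdivrMr// => h.
  rewrite mulrA ler_pdivrMr// ler_pdivrMr//; lra.
set A := [set x | _].
pose F := [set x | exists2 a, codings f x a & forall k, (0 < k)%N -> (B < a k)%N].
have HF := hausdorff_measure0_large_digits s0 HB HS.
pose G w := if positive_word w then comp_word f w @` F else set0.
apply: (@hausdorff_measure0_sub _ _ _ (\bigcup_w G w)); last first.
  apply: hausdorff_measure0_countable_bigcup => w; rewrite /G; case: ifPn => w0; last first.
    by apply/hausdorff_measure_eq0P => delta _; exact: hausdorff_premeasure_set0.
  have L0 : 0 < \prod_(i <- w) lam i + 1 by rewrite ltr_wpDl// prod_word_ge0.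
  apply: (hausdorff_measure0_lipschitz _ _ _ _ (ltW s0) L0 _ HF).
  move=> x y [a xa _] [b yb _].
  apply: (le_trans (comp_word_upper fmem lam_ge0 flam w0 (codings_mem fmem xa) (codings_mem fmem yb))).
  by rewrite ler_wpM2r// lerDl.
move=> x [a xa ainf]; have [a00 a0 _] := xa.
have [M HM] := ainf B.+1.
have [||||y ya] := @codings_exist_of_large B.+1 0 (shift_code M a).
- by move=> i _; exact: HB.
- by [].
- exact: positive_shift_code.
- by move=> [//|k] _; apply: HM; rewrite addnS ltnS leq_addr.
exists (codeword a M) => //; rewrite /G positive_codeword//.
exists y; last exact/esym/(codings_unshift fmem lam_ge0 flam xa ya).
exists (shift_code M a) => // -[//|k] _; apply: HM.
by rewrite addnS ltnS leq_addr.
Qed.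

(** A point meets [a n <= K n] at some length [n >= N], so the cylinders of all these lengths form a
    cover. Nondecreasing words of length [n] over the [K n + 1] letters are multisets, whence the
    binomial, and the factor [2^(-n)] makes the sum over [n] of order [2^(-N)]. *)
Lemma hausdorff_measure0_counting s (K : nat -> nat) (D : nat -> R) (G : R) n0
    (A : set R) : 0 < s -> (forall n, 0 <= D n) ->
  (forall n, (n0 <= n)%N -> 'C(n + K n, n)%:R * D n `^ s <= G * 2^-1 ^+ n) ->
  (forall x, A x -> exists a, [/\ codings f x a,
    forall k l, (0 < k)%N -> (k <= l)%N -> (a k <= a l)%N,
    forall n, \prod_(1 <= k < n.+1) lam (a k) <= D n &
    forall N, exists2 n, (N <= n)%N & (a n <= K n)%N]) ->
  hausdorff_measure s A = 0%E.
Proof.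
move=> s0 D0 HD HA; apply/hausdorff_measure_eq0P => delta d0.
apply/eqP; rewrite eq_le hausdorff_premeasure_ge0 andbT.
apply/lee_addgt0Pr => r r0; rewrite add0e.
have [N1 HN1] := geometric_half_small G (powR_gt0 s d0).
have [N2 HN2] := geometric_half_small (2 * G) r0.
pose N := maxn n0 (maxn N1 N2).
pose cyl n (t : n.-tuple 'I_(K n).+1) := [set x | exists a, [/\ codings f x a,
  forall n, \prod_(1 <= k < n.+1) lam (a k) <= D n & codeword a n = map val t]].
pose S n := finset (fun t : n.-tuple 'I_(K n).+1 => sorted leq (map val t)).
pose F n := \bigcup_(t in [set` enum (S n)]) cyl n t.
have cyl_diam n (t : n.-tuple 'I_(K n).+1) : (diam (cyl n t) <= (D n)%:E)%E.
  apply: diam_le => x y [a [xa aD at_]] [b [yb _ bt]]; rewrite lee_fin.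
  apply: le_trans (aD n); apply: (codings_dist fmem lam_ge0 flam xa yb).
  by rewrite at_ bt.
have cardS n : #|S n| = 'C(n + K n, n) by exact: card_sorted_tuples.
have C_ge1 n : 1 <= 'C(n + K n, n)%:R :> R by rewrite ler1n bin_gt0 leq_addr.
have Fle n : (N <= n)%N -> (hausdorff_premeasure s delta (F n) <= (G * 2^-1 ^+ n)%:E)%E.
  rewrite !geq_max => /and3P[n0n N1n N2n].
  (* The binomial is at least 1, so the hypothesis alone forces [(D n)^s <= G 2^(-n)], and the
     diameters drop below [delta]. *)
  have Dn : D n <= delta.
    rewrite leNgt; apply/negP => dD.
    have /lt_le_trans h : G * 2^-1 ^+ n < D n `^ s.
      by apply: (lt_trans (HN1 _ N1n)); rewrite gt0_ltr_powR ?nnegrE ?D0 ?(ltW d0).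
    have := h _ (ler_peMl (powR_ge0 _ _) (C_ge1 n)).
    by rewrite ltNge HD.
  apply: (le_trans (hausdorff_premeasure_bigcup_seq _ _ _ _ _)).
  apply: (@le_trans _ _ (\sum_(t <- enum (S n)) (D n `^ s)%:E)%E).
    apply: lee_sum => t _; apply: (le_trans (hausdorff_premeasure_diam _ _ _ _)).
      by rewrite (le_trans (cyl_diam n t)).
    exact: diam_pow_le (ltW s0) (D0 n) (cyl_diam n t).
  rewrite sumEFin lee_fin big_enum sumr_const cardS -[D n `^ s *+ _]mulr_natl.
  exact: HD.
have AF : A `<=` \bigcup_m F (N + m)%N.
  move=> x /HA[a [xa amono aD aK]]; have [n Nn an] := aK N.
  exists (n - N)%N => //; rewrite subnKC//.
  (* [inord] loses nothing: by monotonicity all entries are at most [a n <= K n]. *)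
  pose u : seq 'I_(K n).+1 := [seq inord k | k <- codeword a n].
  have us : size u == n by rewrite size_map size_codeword.
  have uE : map val u = codeword a n.
    rewrite -map_comp -[RHS]map_id; apply/eq_in_map => k /mapP[l].
    rewrite mem_iota => /andP[l0 ln] ->; rewrite /= inordK// ltnS (leq_trans _ an)//.
    exact: amono.
  exists (Tuple us); last by exists a.
  rewrite /= mem_enum inE uE /codeword.
  apply: (@homo_sorted_in _ _ [pred k | (0 < k)%N] a leq leq).
  - by move=> k l k0 _; exact: amono.
  - by apply/allP => k; rewrite mem_iota => /andP[].
  - exact: iota_sorted.
apply: (le_trans (le_hausdorff_premeasure _ _ _ _ AF)).
apply: (le_trans (hausdorff_premeasure_sigma_subadditive _ _ _)).
apply: (@le_trans _ _ (\sum_(0 <= m <oo) (G * 2^-1 ^+ (N + m))%:E)%E).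
  apply: lee_nneseries => [k _ _|k _]; first exact: hausdorff_premeasure_ge0.
  by apply: Fle; exact: leq_addr.
have G0 k : 0 <= G * 2^-1 ^+ (N + k).
  rewrite -lee_fin; apply: le_trans (Fle _ (leq_addr _ _)).
  exact: hausdorff_premeasure_ge0.
apply: lime_le; first by apply: is_cvg_nneseries => k _ _; rewrite lee_fin.
apply: nearW => n; rewrite sumEFin lee_fin.
have N2N : (N2 <= N)%N by rewrite /N !leq_max leqnn !orbT.
apply: le_trans (ltW (HN2 _ N2N)).
suff : \sum_(0 <= i < n) G * 2^-1 ^+ (N + i) <= 2 * G * 2^-1 ^+ N - 2 * (G * 2^-1 ^+ (N + n)).
  by have := G0 n; lra.
elim: n => [|n ih]; first by rewrite big_geq// addn0; lra.
by rewrite big_nat_recr//= addnS exprSr; have := G0 n; lra.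
Qed.

(** A bounded nondecreasing sequence of integers is constant from the first occurrences of its
    maximum on. It is thus given by a finite word and a letter, which leaves countably many sets of
    at most one point. *)
Lemma hausdorff_measure0_bounded_digits s : 0 < s ->
  hausdorff_measure s [set x | exists2 a, codings f x a &
    (forall k l, (0 < k)%N -> (k <= l)%N -> (a k <= a l)%N) /\
    exists B, forall k, (a k <= B)%N] = 0%E.
Proof.
move=> s0; set A := [set x | _].
pose F (wi : seq nat * nat) := [set x | exists a, [/\ codings f x a,
  codeword a (size wi.1) = wi.1 & forall k, (size wi.1 < k)%N -> a k = wi.2]].
apply: (@hausdorff_measure0_sub _ _ _ (\bigcup_wi F wi)).
  move=> x [a xa [amono [B aB]]].
  pose P i := `[< exists2 k, (0 < k)%N & a k = i >].
  have exP : exists i, P i by exists (a 1%N); apply/asboolP; exists 1%N.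
  have Pub i : P i -> (i <= B)%N by move=> /asboolP[k _ <-].
  have [i /asboolP[k k0 ak] imax] := ex_maxnP exP Pub.
  exists (codeword a k, i) => //; exists a; rewrite /= size_codeword; split=> // l kl.
  apply/eqP; rewrite eqn_leq -{2}ak (amono k l k0 (ltnW kl)) andbT.
  by apply: imax; apply/asboolP; exists l => //; exact: leq_trans kl.
apply: hausdorff_measure0_countable_bigcup => -[w i]; apply: hausdorff_measure0_diam => //.
apply: diam_le => x y [a [xa aw ai]] [b [yb bw bi]]; rewrite /= in aw bw ai bi.
have ab k : (0 < k)%N -> a k = b k.
  move=> k0; have [kw|wk] := leqP k (size w); last by rewrite ai ?bi.
  by apply: (@codeword_eq a b (size w)); rewrite ?aw ?bw ?k0.
have xyE : x = y.
  case: xa yb => _ _ ax [_ _ bx].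
  have E : (fun n => comp_word f [seq b k | k <- iota 1 n] 1) =
           (fun n => comp_word f [seq a k | k <- iota 1 n] 1).
    apply/funext => n; congr (comp_word f _ 1).
    by apply/esym/eq_codeword => k /andP[k0 _]; exact: ab.
  by rewrite E in bx; exact: cvg_unique ax bx.
by rewrite xyE subrr normr0.
Qed.

Lemma hausdorff_measure0_slow_digits s (c : R) : 0 < s -> 0 <= c -> c < 1 ->
  hausdorff_measure s [set x | exists a, [/\ codings f x a,
    forall k l, (0 < k)%N -> (k <= l)%N -> (a k <= a l)%N,
    forall B, exists M, forall k, (M < k)%N -> (B <= a k)%N &
    forall N, exists2 n, (N <= n)%N & (a n)%:R <= n%:R `^ c]] = 0%E.
Proof.
move=> s0 c0 c1; set A := [set x | _].
have E0 : 0 < expR 1 :> R by exact: expR_gt0.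
have E2 : 0 < (2 * expR 1)^-1 :> R by rewrite invr_gt0 mulr_gt0.
(* [theta^s = 1 / (2 e)], so that [theta^(n s)] turns the bound [e^n] on the number of words into
   [2^(-n)]. *)
pose theta : R := (2 * expR 1)^-1 `^ s^-1.
have t0 : 0 < theta by rewrite powR_gt0.
have ts : theta `^ s = (2 * expR 1)^-1.
  by rewrite -powRrM mulVf ?gt_eqF// powRr1// ltW.
have t1 : theta <= 1.
  have y1 : 0 < (2 * expR (1 : R))^-1 <= 1.
    by rewrite E2/= invf_le1 ?mulr_gt0//; have := expR_ge1Dx (1 : R); lra.
  have si : 0 <= s^-1 by rewrite invr_ge0 ltW.
  by have := ger_powR y1 si; rewrite powRr0.
have [B HB] := lam_small t0; have [n0 Hn0] := bin_truncn_powR_le_expR c0 c1.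
(* The index from which the digits exceed [B] depends on the point; a countable union over [M] makes
   the constants uniform. *)
pose AM M := [set x | exists a, [/\ codings f x a,
    forall k l, (0 < k)%N -> (k <= l)%N -> (a k <= a l)%N,
    forall k, (M < k)%N -> (B <= a k)%N &
    forall N, exists2 n, (N <= n)%N & (a n)%:R <= n%:R `^ c]].
apply: (@hausdorff_measure0_sub _ _ _ (\bigcup_M AM M)).
  by move=> x [a [xa am /(_ B)[M aB] ac]]; exists M => //; exists a.
apply: hausdorff_measure0_bigcup => M.
have [W W0 WE] : exists2 W : R, 0 < W & W = (C / theta) ^+ M.
  by exists ((C / theta) ^+ M) => //; rewrite exprn_gt0// divr_gt0.
apply: (@hausdorff_measure0_counting s (fun n => Num.truncn (n%:R `^ c : R))
  (fun n => W * theta ^+ n) (W `^ s) n0) => //.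
- by move=> n; rewrite mulr_ge0 ?exprn_ge0 ?(ltW W0) ?(ltW t0).
- move=> n /Hn0 h; rewrite powRM ?exprn_ge0 ?(ltW W0) ?(ltW t0)//.
  rewrite mulrCA ler_wpM2l ?powR_ge0// powR_expn ?(ltW t0)// ts.
  apply: (@le_trans _ _ (expR 1 ^+ n * (2 * expR 1)^-1 ^+ n)).
    by rewrite ler_wpM2r// exprn_ge0// ltW.
  by rewrite -exprMn invfM mulrCA mulfV ?gt_eqF// mulr1.
move=> x [a [xa am aB ac]]; exists a; split => //.
  by move=> n; rewrite WE; apply: prod_lam_le HB _ aB => //; case: xa.
move=> N; have [n Nn an] := ac N; exists n => //.
by rewrite truncn_ge_nat ?powR_ge0.
Qed.

(** There are at most [(2 n^b2)^n / n!] words, of diameter at most a constant times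
    [C^n / n!^(e b1)]. With [sigma = s e b1] and [n! >= (n / e)^n], where this last [e] is Euler's
    number, the n-th root of the sum is of order [n^(b2 - 1 - sigma)], which tends to 0 by the last
    hypothesis. *)
Lemma hausdorff_measure0_polynomial_digits s (b1 b2 : R) :
  0 < s -> 0 < b1 -> 1 < b2 -> b2 < 1 + s * (e * b1) ->
  hausdorff_measure s [set x | exists a, [/\ codings f x a,
    forall k l, (0 < k)%N -> (k <= l)%N -> (a k <= a l)%N,
    exists M, forall k, (M < k)%N -> k%:R `^ b1 <= (a k)%:R &
    forall N, exists2 n, (N <= n)%N & (a n)%:R <= n%:R `^ b2]] = 0%E.
Proof.
move=> s0 b10 b21 sb; set A := [set x | _].
pose kappa := e * b1; have kappa0 : 0 < kappa by rewrite mulr_gt0.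
pose AM M := [set x | exists a, [/\ codings f x a,
    forall k l, (0 < k)%N -> (k <= l)%N -> (a k <= a l)%N,
    forall k, (M < k)%N -> k%:R `^ b1 <= (a k)%:R &
    forall N, exists2 n, (N <= n)%N & (a n)%:R <= n%:R `^ b2]].
apply: (@hausdorff_measure0_sub _ _ _ (\bigcup_M AM M)).
  by move=> x [a [xa am [M aB] ac]]; exists M => //; exists a.
apply: hausdorff_measure0_bigcup => M.
(* For [k <= M] the digit is bounded below only by 1; since [k^kappa <= W], the crude bound [C] is
   still at most [W] times [r k]. *)
pose W : R := M.+1%:R `^ kappa.
have W1 : 1 <= W by rewrite nat_powR_ge1// ltW.
have W0 : 0 < W by exact: lt_le_trans W1.
pose r k : R := C / k%:R `^ kappa.
have r0 k : (0 < k)%N -> 0 <= r k.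
  by move=> k0; rewrite divr_ge0 ?powR_ge0// ltW.
have rE n : \prod_(1 <= k < n.+1) r k = C ^+ n / n`!%:R `^ kappa.
  elim: n => [|n ih]; first by rewrite big_geq// fact0 powR1 expr0 divr1.
  rewrite big_nat_recr//= ih factS natrM powRM// exprSr /r.
  by rewrite invfM; ring.
pose sigma := s * kappa.
pose E : R := expR 1; have E0 : 0 < E by exact: expR_gt0.
(* The 4 combines the 2 from the word count with the target ratio 1/2. *)
have [n0 Hn0] : exists n0, forall n, (n0 <= n)%N ->
    4 * C `^ s * E `^ (1 + sigma) <= n%:R `^ (1 + sigma - b2).
  by apply: powR_nat_eventually_ge; rewrite /sigma /kappa; lra.
apply: (@hausdorff_measure0_counting s (fun n => Num.truncn (n%:R `^ b2 : R))
  (fun n => W ^+ M * \prod_(1 <= k < n.+1) r k) ((W ^+ M) `^ s) (maxn 1 n0)) => //.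
- move=> n; rewrite mulr_ge0 ?exprn_ge0 ?(ltW W0)// big_nat.
  by apply: prodr_ge0 => k /andP[k0 _]; exact: r0.
- move=> n; rewrite geq_max => /andP[n1 /Hn0 {}Hn0].
  have X0 : 0 < n%:R :> R by rewrite ltr0n.
  have X1 : 1 <= n%:R :> R by rewrite ler1n.
  have F0 : 0 < n`!%:R :> R by rewrite ltr0n fact_gt0.
  set X : R := n%:R in X0 X1 Hn0 *; set F : R := n`!%:R in F0 *.
  have XE0 : 0 < X / E by rewrite divr_gt0.
  have FX : (X / E) ^+ n <= F.
    by rewrite expr_div_n ler_pdivrMr ?exprn_gt0// mulrC; exact: expn_self_le_fact.
  rewrite rE -/F powRM ?exprn_ge0 ?divr_ge0 ?exprn_ge0 ?powR_ge0 ?(ltW W0) ?(ltW C0)//.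
  rewrite mulrCA ler_wpM2l ?powR_ge0//.
  rewrite powRM ?exprn_ge0 ?invr_ge0 ?powR_ge0 ?(ltW C0)// powR_expn ?(ltW C0)//.
  have -> : ((F `^ kappa)^-1) `^ s = (F `^ sigma)^-1.
    by rewrite -powRN -powRrM -powRN /sigma mulNr mulrC.
  set K := Num.truncn _.
  have KX : K%:R <= X `^ b2 by rewrite truncn_le powR_ge0.
  have XX : X <= X `^ b2 by rewrite -[leLHS]powRr1 ?(ltW X0)// ler_powR// ltW.
  have binF : 'C(n + K, n)%:R <= (2 * X `^ b2) ^+ n / F.
    rewrite ler_pdivlMr// -natrM bin_ffact.
    apply: (@le_trans _ _ ((n + K)%:R ^+ n)); first by rewrite -natrX ler_nat ffact_le_exp.
    rewrite lerXn2r ?nnegrE ?mulr_ge0 ?powR_ge0// natrD.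
    by rewrite -/X; lra.
  apply: (@le_trans _ _ ((2 * X `^ b2) ^+ n / F * ((C `^ s) ^+ n / F `^ sigma))).
    by rewrite ler_wpM2r// divr_ge0 ?exprn_ge0 ?powR_ge0.
  have Fs : ((X / E) `^ (1 + sigma)) ^+ n <= F * F `^ sigma.
    rewrite -powR_expn ?(ltW XE0)// -{1}(powRr1 (ltW F0)) -powRD ?(gt_eqF F0) ?implybT//.
    rewrite ge0_ler_powR ?nnegrE ?exprn_ge0 ?(ltW XE0) ?(ltW F0)//.
    by rewrite /sigma addr_ge0// mulr_ge0 ?(ltW s0)// ltW.
  have Y0 : 0 < ((X / E) `^ (1 + sigma)) by rewrite powR_gt0.
  rewrite mulrACA -exprMn -invfM.
  apply: (@le_trans _ _ ((2 * X `^ b2 * C `^ s) ^+ n / ((X / E) `^ (1 + sigma)) ^+ n)).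
    rewrite ler_wpM2l ?exprn_ge0 ?mulr_ge0 ?powR_ge0//.
    by rewrite lef_pV2 ?posrE ?mulr_gt0 ?powR_gt0 ?exprn_gt0.
  rewrite -expr_div_n lerXn2r ?nnegrE ?divr_ge0 ?mulr_ge0 ?powR_ge0//.
  rewrite ler_pdivrMr//.
  have YE : (X / E) `^ (1 + sigma) * E `^ (1 + sigma) = X `^ b2 * X `^ (1 + sigma - b2).
    rewrite -powRM ?(ltW XE0) ?(ltW E0)// divfK ?gt_eqF// -powRD ?(gt_eqF X0) ?implybT//.
    by congr (_ `^ _); ring.
  have Es0 : 0 < E `^ (1 + sigma) by rewrite powR_gt0.
  rewrite -(ler_pM2r Es0) -[leRHS]mulrA YE.
  have := ler_wpM2l (powR_ge0 X b2) Hn0; lra.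
move=> x [a [xa am aB ac]]; have [_ a0 _] := xa; exists a; split => //.
  move=> n; apply: prod_le_tail => // [k k0|k /andP[k0 kM]|k Mk].
  - exact/lam_ge0/a0.
  - apply: (le_trans (lam_leC (a0 _ k0))); rewrite /r mulrCA ler_peMr ?(ltW C0)//.
    rewrite ler_pdivlMr ?powR_gt0 ?ltr0n// mul1r ge0_ler_powR ?nnegrE ?(ltW kappa0)//.
    by rewrite ler_nat leqW.
  - have k0 : (0 < k)%N by exact: leq_trans Mk.
    rewrite /lam /r ler_pM2l// lef_pV2 ?posrE ?powR_gt0 ?ltr0n ?a0//.
    rewrite /kappa mulrC powRrM ge0_ler_powR ?nnegrE ?powR_ge0 ?(ltW e0)//.
    exact: aB.
move=> N; have [n Nn an] := ac N; exists n => //.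
by rewrite truncn_ge_nat ?powR_ge0.
Qed.

End upper_bounds.

(** * Lower bounds *)

Section separation.
Context {R : realType} {d : R} {f : nat -> R -> R}.
Hypothesis hf : decaying_gauss_like d f.
Implicit Types (i j k m n N : nat) (x y p q : R) (w : seq nat) (a b : nat -> nat).
Local Notation I01 := `[0, 1 : R].

Variable xi : nat -> R.
Hypothesis xi_gt0 : forall i, (0 < i)%N -> 0 < xi i.
Hypothesis fxi : forall i x y, (0 < i)%N -> x \in I01 -> y \in I01 ->
  xi i * `|x - y| <= `|f i x - f i y|.

Let fmem i x : (0 < i)%N -> x \in I01 -> f i x \in I01.
Proof. exact: (dgl_mem hf). Qed.

Let zero01 : 0 \in I01. Proof. by rewrite in_itv/= lexx ler01. Qed.
Let one01 : 1 \in I01. Proof. exact: one_in01. Qed.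

Let image_length i : (0 < i)%N -> xi i <= `|f i 0 - f i 1|.
Proof.
by move=> i0; have := fxi i0 zero01 one01; rewrite sub0r normrN normr1 mulr1.
Qed.

(** The image of [f i.+1], of length at least [xi i.+1], lies between the images of [f i] and
    [f j]. *)
Lemma dgl_gap i j p q : (0 < i)%N -> (i.+1 < j)%N -> p \in I01 -> q \in I01 ->
  xi i.+1 <= `|f i p - f j q|.
Proof.
move=> i0 ij p01 q01; apply: (le_trans (image_length (ltn0Sn i))).
have h1 := dgl_image_le hf i0 (ltnSn i) p01 zero01.
have h2 := dgl_image_le hf i0 (ltnSn i) p01 one01.
have h3 := dgl_image_le hf (ltn0Sn i) ij zero01 q01.
have h4 := dgl_image_le hf (ltn0Sn i) ij one01 q01.
rewrite [leRHS]ger0_norm; last by rewrite subr_ge0 (le_trans h3).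
by rewrite ler_norml; apply/andP; split; lra.
Qed.

(** Inside [0, 1], the image of [f k.+1] lies below [f k p] and that of [f k.-1] above it; their
    lengths keep [f k p] away from 0 and 1. *)
Lemma dgl_image_gap k p : (1 < k)%N -> p \in I01 ->
  f k p \in `[xi k.+1, 1 - xi k.-1].
Proof.
case: k => // k; rewrite ltnS => k0 p01.
have h1 := dgl_image_le hf (ltn0Sn k) (ltnSn k.+1) p01 zero01.
have h2 := dgl_image_le hf (ltn0Sn k) (ltnSn k.+1) p01 one01.
have h3 := dgl_image_le hf k0 (ltnSn k) zero01 p01.
have h4 := dgl_image_le hf k0 (ltnSn k) one01 p01.
have := image_length (ltn0Sn k.+1); have := image_length k0.
have := fmem k0 zero01; have := fmem k0 one01.
have := fmem (ltn0Sn k.+1) zero01; have := fmem (ltn0Sn k.+1) one01.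
rewrite !in_itv/= => /andP[? ?] /andP[? ?] /andP[? ?] /andP[? ?] H1 H2.
apply/andP; split.
  by apply: (le_trans H2); rewrite ler_norml; apply/andP; split; lra.
by rewrite lerBrDl -lerBrDr (le_trans H1)// ler_norml; apply/andP; split; lra.
Qed.

(** Adjacent images may touch, so a difference in one digit does not separate points. A next digit
    [k >= 2] keeps [f k p] away from 0 and 1, hence [f i (f k p)] away from both ends of the image
    of [f i], and [f j q] lies at or beyond one of these ends. *)
Lemma dgl_interior_gap i j k p q : (0 < i)%N -> (0 < j)%N -> i != j -> (1 < k)%N ->
  p \in I01 -> q \in I01 ->
  xi i * Num.min (xi k.+1) (xi k.-1) <= `|f i (f k p) - f j q|.
Proof.
move=> i0 j0 ij k1 p01 q01; set y := f k p; set c := Num.min _ _.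
have y01 : y \in I01 by apply: fmem => //; exact: ltnW.
have /andP[y0 y1] : (0 <= y) && (y <= 1) by move: y01; rewrite in_itv.
have [cy cy1] : c <= y /\ c <= 1 - y.
  have := dgl_image_gap k1 p01; rewrite in_itv/= -/y => /andP[h1 h2].
  by rewrite !ge_min; split; apply/orP; [left|right]; lra.
have k0 : (0 < k.-1)%N by case: k k1 {y c y01 y0 y1 cy cy1} => [|[]].
have c0 : 0 < c by rewrite lt_min !xi_gt0.
have xi0 := xi_gt0 i0.
have H0 : xi i * c <= `|f i y - f i 0|.
  apply: le_trans (fxi i0 y01 zero01); rewrite subr0 ger0_norm//.
  by rewrite ler_pM2l.
have H1 : xi i * c <= `|f i y - f i 1|.
  apply: le_trans (fxi i0 y01 one01); rewrite distrC ger0_norm ?subr_ge0//.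
  by rewrite ler_pM2l.
have ylt0 : 0 < y by lra.
have ylt1 : y < 1 by lra.
(* The two cases are the two orientations of [f i]. *)
have : (`|f i y - f i 0| = f i y - f i 0 /\ `|f i y - f i 1| = f i 1 - f i y) \/
       (`|f i y - f i 0| = f i 0 - f i y /\ `|f i y - f i 1| = f i y - f i 1).
  have [inc|dec] := dgl_mono hf i0; [left|right].
    have a1 := inc _ _ zero01 y01 ylt0; have a2 := inc _ _ y01 one01 ylt1.
    by rewrite ger0_norm ?ler0_norm ?opprB//; lra.
  have a1 := dec _ _ y01 zero01 ylt0; have a2 := dec _ _ one01 y01 ylt1.
  by rewrite ler0_norm ?ger0_norm ?opprB//; lra.
have [lij|lji|eij] := ltngtP i j; last by rewrite eij eqxx in ij.
  have h1 := dgl_image_le hf i0 lij zero01 q01.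
  have h2 := dgl_image_le hf i0 lij one01 q01.
  have h3 := dgl_image_le hf i0 lij y01 q01.
  rewrite [leRHS]ger0_norm ?subr_ge0//.
  by move=> [[E0 E1]|[E0 E1]]; rewrite E0 in H0; rewrite E1 in H1; lra.
have h1 := dgl_image_le hf j0 lji q01 zero01.
have h2 := dgl_image_le hf j0 lji q01 one01.
have h3 := dgl_image_le hf j0 lji q01 y01.
rewrite [leRHS]ler0_norm ?subr_le0//.
by move=> [[E0 E1]|[E0 E1]]; rewrite E0 in H0; rewrite E1 in H1; lra.
Qed.

(** At the first difference with any other coding, the next digit of [a], being at least 2, gives a
    gap that survives the limit; this would make [|x - x|] positive. The competing coding [b] may
    contain the digit 1. *)
Lemma codings_unique a x : (forall k, (0 < k)%N -> (1 < a k)%N) ->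
  codings f x a -> forall b, codings f x b -> a = b.
Proof.
move=> a1 [a00 a0 ax] b [b00 b0 bx].
suff ab n : a n = b n by apply/funext.
apply/eqP/negP => /negP abn.
have exP : exists n, a n != b n by exists n.
have {n abn exP} [m abm mmin] := ex_minnP exP.
have m0 : (0 < m)%N by case: m abm {mmin} => //; rewrite a00 b00 eqxx.
case: m abm mmin m0 => // m abm mmin _.
have abw : codeword a m = codeword b m.
  apply: eq_codeword => k /andP[_ km]; apply/eqP/negP => /negP /mmin.
  by rewrite ltnNge km.
have aw := positive_codeword m a0.
have P0 : 0 < \prod_(i <- codeword a m) xi i.
  by rewrite big_seq; apply: prodr_gt0 => i iw; apply: xi_gt0; move/allP: aw; apply.
pose c := xi (a m.+1) * Num.min (xi (a m.+2).+1) (xi (a m.+2).-1).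
have k0 : (0 < (a m.+2).-1)%N by have := a1 m.+2 isT; case: (a m.+2) => [|[]].
have c0 : 0 < c by rewrite mulr_gt0 ?lt_min ?xi_gt0// a0.
suff : (\prod_(i <- codeword a m) xi i) * c <= `|x - x|.
  by rewrite subrr normr0 leNgt mulr_gt0.
apply: (cvg_dist_ge (n := (m + 2)%N) ax bx) => N mN.
rewrite -/(codeword a N) -/(codeword b N) -(subnKC mN) -addnA add2n !codeword_cat -abw !comp_word_cat.
rewrite !codewordSl /= !addn1 addn2.
have aS := positive_shift_code m a0; have bS := positive_shift_code m b0.
set wa := codeword (shift_code 1 (shift_code 1 (shift_code m a))) _.
set wb := codeword (shift_code 1 (shift_code 1 (shift_code m b))) _.
have wa0 : positive_word wa by do 3! apply: positive_codeword || apply: positive_shift_code.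
have wb0 : positive_word wb by do 3! apply: positive_codeword || apply: positive_shift_code.
have pa := comp_word_mem fmem wa0 one01.
have pb := fmem (b0 m.+2 isT) (comp_word_mem fmem wb0 one01).
have pa2 := fmem (a0 m.+1 isT) (fmem (a0 m.+2 isT) pa).
have pb2 := fmem (b0 m.+1 isT) pb.
apply: le_trans (comp_word_lower fmem _ fxi aw pa2 pb2); last first.
  by move=> i i0; rewrite ltW ?xi_gt0.
rewrite ler_pM2l//.
exact: dgl_interior_gap (a0 m.+1 isT) (b0 m.+1 isT) abm (a1 m.+2 isT) pa pb.
Qed.

Lemma codings_interior a x : (forall k, (0 < k)%N -> (1 < a k)%N) ->
  codings f x a -> x \in `]0, 1[.
Proof.
move=> a1 [a00 a0 ax].
have : x \in `[xi (a 1).+1, 1 - xi (a 1).-1].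
  apply: (cvg_itvcc (n := 1) ax) => -[//|N] _.
  rewrite -/(codeword a N.+1) codewordSl /=; apply: dgl_image_gap; first exact: a1.
  apply: (comp_word_mem fmem) one01.
  by apply: positive_codeword; exact: positive_shift_code.
have k0 : (0 < (a 1).-1)%N by have := a1 1 isT; case: (a 1) => [|[]].
have := xi_gt0 k0; have := xi_gt0 (ltn0Sn (a 1)).
by rewrite !in_itv/= => ? ? /andP[? ?]; apply/andP; split; lra.
Qed.

Lemma codings_separated a b n x y : codings f x a -> codings f y b ->
  (forall k, (0 < k <= n)%N -> a k = b k) -> ((a n.+1).+1 < b n.+1)%N ->
  (\prod_(1 <= k < n.+1) xi (a k)) * xi (a n.+1).+1 <= `|x - y|.
Proof.
move=> [a00 a0 ax] [b00 b0 bx] /eq_codeword abw ab.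
have aw := positive_codeword n a0.
have P0 : 0 < \prod_(i <- codeword a n) xi i.
  by rewrite big_seq; apply: prodr_gt0 => i iw; apply: xi_gt0; move/allP: aw; apply.
rewrite -prod_codeword.
apply: (cvg_dist_ge (n := (n + 1)%N) ax bx) => N mN.
rewrite -/(codeword a N) -/(codeword b N) -(subnKC mN) -addnA add1n !codeword_cat -abw !comp_word_cat.
rewrite !codewordSl /= !addn1.
have aS := positive_shift_code n a0; have bS := positive_shift_code n b0.
set wa := codeword (shift_code 1 (shift_code n a)) _.
set wb := codeword (shift_code 1 (shift_code n b)) _.
have wa0 : positive_word wa by do 2! apply: positive_codeword || apply: positive_shift_code.
have wb0 : positive_word wb by do 2! apply: positive_codeword || apply: positive_shift_code.
have pa := comp_word_mem fmem wa0 one01.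
have pb := comp_word_mem fmem wb0 one01.
have pa2 := fmem (a0 n.+1 isT) pa.
have pb2 := fmem (b0 n.+1 isT) pb.
apply: le_trans (comp_word_lower fmem _ fxi aw pa2 pb2); last first.
  by move=> i i0; rewrite ltW ?xi_gt0.
rewrite ler_pM2l//.
exact: dgl_gap (a0 n.+1 isT) ab pa pb.
Qed.

End separation.

(** * Mixed radix expansions of the points of [0, 1[ *)

Section mixed_radix.
Context {R : realType}.
Variable Q : nat -> nat.
Hypothesis Q1 : forall k, (0 < k)%N -> (1 < Q k)%N.
Implicit Types (x y : R) (n k : nat).

Let P n : R := \prod_(1 <= k < n.+1) (Q k)%:R.

Let P_gt0 n : 0 < P n.
Proof.
rewrite /P big_nat; apply: prodr_gt0 => k /andP[k0 _].
by rewrite ltr0n; exact/ltnW/Q1.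
Qed.

Let PS n : P n.+1 = P n * (Q n.+1)%:R.
Proof. by rewrite /P big_nat_recr. Qed.

Let P_ge n : 2 ^+ n <= P n.
Proof.
elim: n => [|n ih]; first by rewrite /P big_geq.
by rewrite PS exprSr ler_pM// ler_nat Q1.
Qed.

(** The digit [d_n] of the Cantor series [x = d_1 / Q_1 + d_2 / (Q_1 Q_2) + ...]. *)
Definition radix_digit x n : nat := (Num.truncn (x * P n) %% Q n)%N.

Lemma ltn_radix_digit x n : (0 < n)%N -> (radix_digit x n < Q n)%N.
Proof. by move=> n0; rewrite ltn_pmod// ltnW// Q1. Qed.

Lemma truncn_mul_div x k : 0 <= x -> (0 < k)%N ->
  (Num.truncn (x * k%:R) %/ k = Num.truncn x)%N.
Proof.
move=> x0 k0; have k0' : 0 < k%:R :> R by rewrite ltr0n.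
have /andP[h1 h2] := truncn_itv x0.
set q := Num.truncn x in h1 h2 *; set t := Num.truncn _.
have qt : (q * k <= t)%N.
  by rewrite truncn_ge_nat ?mulr_ge0 ?(ltW k0')// natrM ler_pM2r.
have tq : (t < q.+1 * k)%N.
  by rewrite truncn_lt_nat ?mulr_ge0 ?(ltW k0')// natrM ltr_pM2r.
by apply/eqP; rewrite eqn_leq -ltnS ltn_divLR// tq leq_divRL.
Qed.

(** Dividing the integer part of [x P_(n+1)] by [Q_(n+1)] gives that of [x P_n] as quotient and the
    digit as remainder. So the first [n] digits determine the integer part of [x P_n]. *)
Lemma eq_radix_digit_dist x y n : x \in `[0, 1[ -> y \in `[0, 1[ ->
  (forall k, (0 < k <= n)%N -> radix_digit x k = radix_digit y k) ->
  `|x - y| <= (P n)^-1.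
Proof.
rewrite !in_itv/= => /andP[x0 x1] /andP[y0 y1] xy.
have : Num.truncn (x * P n) = Num.truncn (y * P n).
  elim: n xy => [_|n ih xy].
    rewrite /P big_geq// !mulr1.
    by rewrite (@truncn_def _ x 0) ?(@truncn_def _ y 0)// ?x0 ?y0.
  have {}ih : Num.truncn (x * P n) = Num.truncn (y * P n).
    by apply: ih => k /andP[k0 kn]; rewrite xy// k0 leqW.
  rewrite [LHS](divn_eq _ (Q n.+1)) [RHS](divn_eq _ (Q n.+1)).
  have := xy n.+1; rewrite ltnSn => /(_ isT); rewrite /radix_digit => ->.
  by rewrite PS !mulrA !truncn_mul_div ?ih ?mulr_ge0 ?(ltW (P_gt0 n))// ltnW ?Q1.
have xP0 : 0 <= x * P n by rewrite mulr_ge0// ltW.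
have yP0 : 0 <= y * P n by rewrite mulr_ge0// ltW.
have := truncn_itv xP0; have := truncn_itv yP0.
move=> + + E; rewrite E -natr1 => /andP[h1 h2] /andP[h3 h4].
rewrite -(ler_pM2r (P_gt0 n)) mulVf ?gt_eqF// -{1}(ger0_norm (ltW (P_gt0 n))) -normrM.
by rewrite mulrBl ler_norml; apply/andP; split; lra.
Qed.

Lemma radix_digit_first_diff x y : x \in `[0, 1[ -> y \in `[0, 1[ -> x != y ->
  exists2 n, radix_digit x n.+1 != radix_digit y n.+1 &
    forall k, (0 < k <= n)%N -> radix_digit x k = radix_digit y k.
Proof.
move=> x01 y01 xy.
have exP : exists n, radix_digit x n.+1 != radix_digit y n.+1.
  apply: contrapT => /forallNP H.
  have xy0 : 0 < `|x - y| by rewrite normr_gt0 subr_eq0.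
  have [n Hn] := geometric_half_small 1 xy0.
  have := Hn n (leqnn n); rewrite mul1r ltNge => /negP; apply.
  have : `|x - y| <= (P n)^-1.
    apply: eq_radix_digit_dist => // -[//|k] _; apply/eqP/negP => /negP.
    by have := H k.
  move=> /le_trans; apply; rewrite exprVn lef_pV2 ?posrE ?exprn_gt0 ?P_ge//.
have [n nP nmin] := ex_minnP exP.
exists n => // -[//|k] /andP[_ kn]; apply/eqP/negP => /negP /nmin.
by rewrite leqNgt kn.
Qed.

End mixed_radix.

(** Extracts the constant of the inequality [|x - y| <= C |G x - G y|^s] from a growth condition
    known only for large indices. *)
Lemma eventually_nondecreasing_lbound (R : realFieldType) (T : nat -> R) n0 :
  (forall n, 0 < T n) -> (forall n, (n0 <= n)%N -> T n <= T n.+1) ->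
  exists2 c, 0 < c & forall n, c <= T n.
Proof.
elim: n0 => [|n0 ih] T0 TS.
  exists (T 0%N) => // n; elim: n => // n ihn; exact: le_trans ihn (TS _ _).
have [c c0 cT] : exists2 c, 0 < c & forall n, (n0.+1 <= n)%N -> c <= T n.
  exists (T n0.+1) => // n; elim: n => // n ihn; rewrite leq_eqVlt => /orP[/eqP <-//|].
  by rewrite ltnS => n0n; exact: le_trans (ihn n0n) (TS _ n0n).
have [c' c'0 c'T] : exists2 c', 0 < c' & forall n, (n <= n0)%N -> c' <= T n.
  elim: (n0) => [|m [c' c'0 H]]; first by exists (T 0%N) => // n; rewrite leqn0 => /eqP->.
  exists (Num.min c' (T m.+1)); first by rewrite lt_min c'0 T0.
  move=> n; rewrite leq_eqVlt => /orP[/eqP->|nm]; first by rewrite ge_min lexx orbT.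
  by rewrite ge_min H.
exists (Num.min c c'); first by rewrite lt_min c0.
by move=> n; rewrite ge_min; have [/c'T->|/cT->] := leqP n n0; rewrite ?orbT.
Qed.

Section lower_bound.
Context {R : realType} {d : R} {f : nat -> R -> R}.
Hypothesis hf : decaying_gauss_like d f.
Implicit Types (i j k m n : nat) (x y : R) (a b : nat -> nat).
Local Notation I01 := `[0, 1 : R].

Variables (C1 e1 : R).
Hypotheses (C10 : 0 < C1) (e10 : 0 <= e1).
Let xi i : R := C1 / i%:R `^ e1.
Hypothesis fxi : forall i x y, (0 < i)%N -> x \in I01 -> y \in I01 ->
  xi i * `|x - y| <= `|f i x - f i y|.

Variables (C2 e2 : R).
Hypotheses (C21 : 1 <= C2) (e20 : 0 < e2).
Hypothesis flam : forall i x y, (0 < i)%N -> x \in I01 -> y \in I01 ->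
  `|f i x - f i y| <= C2 / i%:R `^ e2 * `|x - y|.

Let xi_gt0 i : (0 < i)%N -> 0 < xi i.
Proof. by move=> i0; rewrite divr_gt0// powR_gt0// ltr0n. Qed.

Let xi_anti i j : (0 < i)%N -> (i <= j)%N -> xi j <= xi i.
Proof.
move=> i0 ij; have j0 : (0 < j)%N by exact: leq_trans ij.
rewrite ler_pM2l// lef_pV2 ?posrE ?powR_gt0 ?ltr0n//.
by rewrite ge0_ler_powR ?nnegrE ?ler_nat.
Qed.

(* The digits are [u k + 2 j] with [j < Q k]: as every second digit is skipped,
   the images of two words that differ are separated by the image of a word. *)
Lemma hausdorff_measure_window_neq0 s (u Q : nat -> nat) (A : set R) n0 :
  0 <= s ->
  (forall k, (0 < k)%N -> (1 < u k)%N) -> (forall k, (0 < k)%N -> (1 < Q k)%N) ->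
  (forall B, exists M, forall k, (M < k)%N -> (B <= u k)%N) ->
  (forall n, (n0 <= n)%N -> 1 <= xi (u n.+1 + 2 * Q n.+1)%N `^ s * (Q n)%:R) ->
  (forall a x, codings f x a ->
    (forall k, (0 < k)%N -> (u k <= a k)%N /\ (a k + 2 <= u k + 2 * Q k)%N) -> A x) ->
  hausdorff_measure s A != 0%E.
Proof.
move=> s0 u1 Q1 uinf hgrow HA.
pose a (x : R) k := if k is 0 then 0%N else (u k + 2 * radix_digit Q x k)%N.
have aP x k : (0 < k)%N -> (u k <= a x k)%N /\ (a x k + 2 <= u k + 2 * Q k)%N.
  by case: k => // k _; have := ltn_radix_digit Q1 x (ltn0Sn k); rewrite /a; lia.
have a1 x k : (0 < k)%N -> (1 < a x k)%N.
  by move=> k0; have [h _] := aP x k k0; exact: leq_trans (u1 _ k0) h.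
have a0 x : positive_code (a x) by move=> k k0; rewrite ltnW// a1.
have Gex x : exists y, codings f y (a x).
  have C20 : 0 < C2 by exact: lt_le_trans C21.
  have [B HB] := @powR_nat_eventually_ge R (C2 / 2^-1) _ e20.
  have [M HM] := uinf B.
  apply: (@codings_exist_of_large R f (dgl_mem hf) C2 e2 C21 e20 flam B M) => //.
    move=> i i0 /HB; rewrite ler_pdivrMr// => h.
    by rewrite ler_pdivrMr ?powR_gt0 ?ltr0n// mulrC.
  move=> k Mk; apply: leq_trans (HM _ Mk) _.
  by have [] := aP x k (leq_trans (ltn0Sn _) Mk).
have [G HG] := choice Gex.
pose b k := (u k + 2 * Q k)%N.
have b0 k : (0 < k)%N -> (0 < b k)%N.
  by move=> /u1 /ltnW h; rewrite /b addn_gt0 h.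
pose l n : R := \prod_(1 <= k < n.+1) xi (b k).
have l0 n : 0 < l n.
  by rewrite /l big_nat; apply: prodr_gt0 => k /andP[k0 _]; exact/xi_gt0/b0.
pose P n : R := \prod_(1 <= k < n.+1) (Q k)%:R.
have P0 n : 0 < P n.
  rewrite /P big_nat; apply: prodr_gt0 => k /andP[k0 _].
  by rewrite ltr0n; exact/ltnW/Q1.
(* If digits first differ at [n + 1], the preimages are within [1 / P n] and the images at least
   [l n.+1] apart. The growth hypothesis says that the ratio of consecutive values of this product
   is eventually at least 1. *)
have [c c0 cT] : exists2 c, 0 < c & forall n, c <= l n.+1 `^ s * P n.
  apply: (@eventually_nondecreasing_lbound _ _ n0) => [n|n n0n].
    by rewrite mulr_gt0 ?powR_gt0.
  have PS : P n.+1 = P n * (Q n.+1)%:R by rewrite /P big_nat_recr.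
  have lS : l n.+2 = l n.+1 * xi (b n.+2) by rewrite /l big_nat_recr.
  rewrite PS lS powRM ?(ltW (l0 _)) ?(ltW (xi_gt0 (b0 _ _)))// mulrACA ler_peMr//.
    by rewrite mulr_ge0 ?powR_ge0// ltW// P0.
  exact: hgrow (leqW n0n).
apply: (hausdorff_measure_gt0 s c^-1 G A s0).
- by rewrite invr_gt0.
- by move=> x _; apply: HA (HG x) (aP x).
have sep x y n : (forall k, (0 < k <= n)%N -> radix_digit Q x k = radix_digit Q y k) ->
    (radix_digit Q x n.+1 < radix_digit Q y n.+1)%N -> l n.+1 <= `|G x - G y|.
  move=> xy xyn; apply: le_trans (codings_separated (n := n) hf xi_gt0 fxi (HG x) (HG y) _ _).
  - rewrite /l big_nat_recr//= ler_pM//; last 1 first.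
    + apply: xi_anti => //; have [_ h] := aP x n.+1 isT.
      by apply: (leq_trans _ h); rewrite addn2.
    + by rewrite -/(l n) ltW.
    + by rewrite ltW// xi_gt0// b0.
    rewrite !big_nat; apply: ler_prod => k /andP[k0 _].
    rewrite ltW ?xi_gt0 ?b0//=; apply: xi_anti; first exact: a0.
    by have [_ h] := aP x k k0; apply: (leq_trans _ h); rewrite leq_addr.
  - by case=> // k kn; rewrite /a xy.
  - by rewrite /a; lia.
move=> x y x01 y01; have [->|xy] := eqVneq x y.
  by rewrite subrr normr0 mulr_ge0 ?powR_ge0// invr_ge0 ltW.
have [n nxy kxy] := radix_digit_first_diff Q1 x01 y01 xy.
have ln : l n.+1 <= `|G x - G y|.
  move: nxy; rewrite neq_ltn => /orP[|yx]; first exact: sep.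
  by rewrite distrC; apply: sep yx => k kn; rewrite kxy.
apply: (le_trans (eq_radix_digit_dist Q1 x01 y01 kxy)).
apply: (@le_trans _ _ (c^-1 * l n.+1 `^ s)).
  rewrite -/(P n) -[leLHS]mul1r ler_pdivrMr// -mulrA ler_pdivlMl// mulr1.
  exact: cT.
rewrite ler_pM2l ?invr_gt0// ge0_ler_powR ?nnegrE//.
exact: ltW.
Qed.

End lower_bound.

(** * Growth exponents *)

Section lower_limits.
Context {R : realType}.
Implicit Types (u : nat -> \bar R) (A : \bar R).
Local Open Scope ereal_scope.

Lemma limn_einf_ge u A N : (forall n, (N <= n)%N -> A <= u n) -> A <= limn_einf u.
Proof.
move=> H; rewrite limn_einf_lim; apply: lime_ge; first exact: is_cvg_einfs.
exists N => // n /= Nn; apply: le_ereal_inf_tmp => _ [k /= nk <-].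
by apply: H; exact: leq_trans nk.
Qed.

Lemma limn_einf_le u A : (forall N, exists2 n, (N <= n)%N & u n <= A) ->
  limn_einf u <= A.
Proof.
move=> H; rewrite limn_einf_lim; apply: lime_le; first exact: is_cvg_einfs.
apply: nearW => N; have [n Nn un] := H N.
by apply: le_trans un; apply: ereal_inf_lbound; exists n.
Qed.

Lemma limn_einf_lt u A : limn_einf u < A -> forall N, exists2 n, (N <= n)%N & u n < A.
Proof.
move=> uA N; apply: contrapT => H; move: uA; apply/negP; rewrite -leNgt.
apply: (@limn_einf_ge _ _ N) => n Nn; rewrite leNgt; apply/negP => un.
by apply: H; exists n.
Qed.

Lemma limn_einf_gt u A : A < limn_einf u -> exists N, forall n, (N <= n)%N -> A < u n.
Proof.
move=> uA; apply: contrapT => /forallNP H; move: uA; apply/negP; rewrite -leNgt.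
apply: limn_einf_le => N; have /existsNP[n /not_implyP[Nn /negP un]] := H N.
by exists n => //; rewrite leNgt.
Qed.

End lower_limits.

Section digit_growth.
Context {R : realType} (m : nat) (t : 'I_m.+1 -> R).
Hypothesis t_ge0 : forall i, 0 <= t i.
Hypothesis S_gt0 : 0 < \sum_(i < m.+1) t i.
Implicit Types (a : nat -> nat) (n k : nat) (A : R).
Local Notation Sigma := (\sum_(i < m.+1) t i).

Definition growth_exponent a n : R :=
  ln (\prod_(i < m.+1) (a (n + i)%N)%:R `^ t i) / ln n%:R.

Lemma ln_prod_powR a n : positive_code a -> (0 < n)%N ->
  ln (\prod_(i < m.+1) (a (n + i)%N)%:R `^ t i) = \sum_(i < m.+1) t i * ln (a (n + i)%N)%:R :> R.
Proof.
move=> a0 n0.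
suff : 0 < \prod_(i < m.+1) (a (n + i)%N)%:R `^ t i /\
  ln (\prod_(i < m.+1) (a (n + i)%N)%:R `^ t i) = \sum_(i < m.+1) t i * ln (a (n + i)%N)%:R :> R by case.
elim/big_ind2 : _ => [|x1 x2 y1 y2 [p1 E1] [p2 E2]|i _].
- by rewrite ln1.
- by split; [rewrite mulr_gt0|rewrite lnM ?posrE// E1 E2].
- rewrite ln_powR powR_gt0// ltr0n; apply: a0.
  by rewrite addn_gt0 n0.
Qed.

Lemma ln_nat_gt0 n : (1 < n)%N -> 0 < ln n%:R :> R.
Proof. by move=> n1; rewrite ln_gt0// ltr1n. Qed.

(** [a n] is the least of the digits involved, so [(a n)^Sigma] is at most the product. *)
Lemma growth_exponent_lt a n A : positive_code a ->
  (forall k l, (0 < k)%N -> (k <= l)%N -> (a k <= a l)%N) -> (1 < n)%N ->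
  growth_exponent a n < A -> (a n)%:R <= n%:R `^ (A / Sigma).
Proof.
move=> a0 am n1; have n0 : (0 < n)%N by exact: ltnW.
rewrite /growth_exponent ltr_pdivrMr ?ln_nat_gt0// ln_prod_powR// => h.
have an0 : 0 < (a n)%:R :> R by rewrite ltr0n a0.
rewrite -(lnK (an0 : (a n)%:R \is Num.pos)) /powR gt_eqF ?ltr0n// ler_expR.
rewrite mulrAC ler_pdivlMr// (le_trans _ (ltW h))// mulr_sumr.
apply: ler_sum => i _; rewrite mulrC ler_wpM2l// ler_ln ?posrE ?ltr0n ?a0 ?addn_gt0 ?n0//.
by rewrite ler_nat am// leq_addr.
Qed.

(** Here the largest digit involved, [a (n + m)], bounds the product, hence the shift by [m]. *)
Lemma growth_exponent_gt a n A : positive_code a ->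
  (forall k l, (0 < k)%N -> (k <= l)%N -> (a k <= a l)%N) -> (1 < n)%N ->
  A < growth_exponent a n -> n%:R `^ (A / Sigma) <= (a (n + m)%N)%:R.
Proof.
move=> a0 am n1; have n0 : (0 < n)%N by exact: ltnW.
rewrite /growth_exponent ltr_pdivlMr ?ln_nat_gt0// ln_prod_powR// => h.
have nm0 : (0 < n + m)%N by rewrite addn_gt0 n0.
have an0 : 0 < (a (n + m)%N)%:R :> R by rewrite ltr0n a0.
rewrite -(lnK (an0 : (a (n + m)%N)%:R \is Num.pos)) /powR gt_eqF ?ltr0n// ler_expR.
rewrite mulrAC ler_pdivrMr// (le_trans (ltW h))// mulr_sumr.
apply: ler_sum => i _; rewrite [leRHS]mulrC ler_wpM2l// ler_ln ?posrE ?ltr0n ?a0 ?addn_gt0 ?n0//.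
by rewrite ler_nat am ?addn_gt0 ?n0// leq_add2l -ltnS.
Qed.

Lemma growth_exponent_ge a n (z : R) : positive_code a -> (1 < n)%N ->
  (forall k, (n <= k)%N -> z * ln n%:R <= ln (a k)%:R) -> z * Sigma <= growth_exponent a n.
Proof.
move=> a0 n1 H; rewrite /growth_exponent ler_pdivlMr ?ln_nat_gt0// ln_prod_powR//; last exact: ltnW.
rewrite mulrAC mulr_sumr; apply: ler_sum => i _.
by rewrite mulrC ler_wpM2l// H// leq_addr.
Qed.

Lemma growth_exponent_le a n (z c : R) : positive_code a -> (1 < n)%N ->
  (forall k, (n <= k <= n + m)%N -> ln (a k)%:R <= z * ln n%:R + c) ->
  growth_exponent a n <= z * Sigma + c * Sigma / ln n%:R.
Proof.
move=> a0 n1 H; have L0 := ln_nat_gt0 n1.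
rewrite /growth_exponent ler_pdivrMr// ln_prod_powR//; last exact: ltnW.
rewrite mulrDl divfK ?gt_eqF// mulrAC -mulrDl mulr_sumr; apply: ler_sum => i _.
by rewrite mulrC ler_wpM2r// H// leq_addr leq_add2l -ltnS ltn_ord.
Qed.

Lemma growth_exponent_cvg_power a (z c : R) : 0 <= z -> 0 < c -> positive_code a ->
  (forall k, (0 < k)%N -> k%:R `^ z <= (a k)%:R <= c * k%:R `^ z) ->
  limn_einf (fun n => (growth_exponent a n)%:E) = (z * Sigma)%:E.
Proof.
move=> z0 c0 a0 H; apply/eqP; rewrite eq_le; apply/andP; split.
  apply/lee_addgt0Pr => r r0; apply: limn_einf_le => N.
  (* For [n <= k <= n + m] one has [k <= (m + 1) n], so [ln (a k) <= z ln n + c']; the next [n] is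
     large enough for [c' Sigma / ln n <= r]. *)
  pose c' := ln c + z * ln m.+1%:R.
  pose n := maxn N (maxn 2 (Num.truncn (expR (c' * Sigma / r))).+1).
  have n1 : (1 < n)%N by rewrite /n !leq_max leqnn orbT.
  have n0 : (0 < n)%N by exact: ltnW.
  have n0' : 0 < n%:R :> R by rewrite ltr0n.
  have L0 := ln_nat_gt0 n1.
  exists n; first by rewrite leq_maxl.
  rewrite -EFinD lee_fin; apply: (@le_trans _ _ (z * Sigma + c' * Sigma / ln n%:R)).
    apply: growth_exponent_le => // k /andP[nk knm].
    have k0 : (0 < k)%N by exact: leq_trans nk.
    have /andP[_ h] := H k k0.
    have k0' : 0 < k%:R :> R by rewrite ltr0n.
    apply: (@le_trans _ _ (ln (c * k%:R `^ z))).
      by rewrite ler_ln ?posrE ?mulr_gt0 ?powR_gt0 ?ltr0n ?a0.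
    rewrite lnM ?posrE ?powR_gt0// ln_powR /c' addrCA lerD2l -mulrDr ler_wpM2l//.
    rewrite -lnM ?posrE// ler_ln ?posrE ?mulr_gt0//.
    by rewrite -natrM ler_nat (leq_trans knm)// mulnS leq_add2l leq_pmull.
  rewrite lerD2l ler_pdivrMr// [leRHS]mulrC -ler_pdivrMr//.
  rewrite -[leLHS]expRK ler_ln ?posrE ?expR_gt0//.
  apply: (le_trans (ltW (truncnS_gt _))).
  by rewrite ler_nat /n !leq_max leqnn !orbT.
apply: (@limn_einf_ge _ _ _ 2) => n n1; rewrite lee_fin.
apply: growth_exponent_ge => // k nk.
have n0 : 0 < n%:R :> R by rewrite ltr0n ltnW.
have k0 : (0 < k)%N by exact: leq_trans (ltnW n1) nk.
have /andP[h _] := H k k0.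
rewrite -ln_powR ler_ln ?posrE ?powR_gt0 ?ltr0n ?a0 ?(ltnW n1)//.
apply: le_trans h; rewrite ge0_ler_powR ?nnegrE ?(ltW n0)//.
by rewrite ler_nat.
Qed.

Lemma growth_exponent_cvg_exponential a : positive_code a ->
  (forall k, (0 < k)%N -> (2 ^ k <= a k)%N) ->
  limn_einf (fun n => (growth_exponent a n)%:E) = +oo%E.
Proof.
move=> a0 H; apply/eqyP => A A0; pose z := A / Sigma.
have z0 : 0 < z by rewrite divr_gt0.
have l2 : 0 < ln 2 :> R by rewrite ln_gt0// ltr1n.
(* From [ln n = 2 ln (n^(1/2)) <= 2 n^(1/2)], the bound [z ln n <= n ln 2] follows once
   [2 z / ln 2 <= n^(1/2)]. *)
have [N HN] := @powR_nat_eventually_ge R (2 * z / ln 2) 2^-1 (ltac:(by [])).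
apply: (@limn_einf_ge _ _ _ (maxn 2 N)) => n; rewrite geq_max => /andP[n1 /HN h].
have n0 : 0 < n%:R :> R by rewrite ltr0n ltnW.
rewrite lee_fin -[leLHS](divfK (lt0r_neq0 S_gt0)).
apply: growth_exponent_ge => // k nk.
have k0 : (0 < k)%N by exact: leq_trans (ltnW n1) nk.
have X0 : 0 < n%:R `^ 2^-1 :> R by rewrite powR_gt0.
have XX : n%:R `^ 2^-1 * n%:R `^ 2^-1 = n%:R :> R.
  rewrite -powRD ?(gt_eqF n0) ?implybT//.
  by rewrite (_ : 2^-1 + 2^-1 = 1) ?powRr1 ?(ltW n0)//; field.
apply: (@le_trans _ _ (n%:R * ln 2)).
  have -> : ln n%:R = 2 * ln (n%:R `^ 2^-1) :> R.
    by rewrite ln_powR mulrA mulfV ?mul1r.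
  rewrite mulrA [z * 2]mulrC.
  apply: (@le_trans _ _ (2 * z * n%:R `^ 2^-1)).
    have z2 : 0 <= 2 * z by rewrite mulr_ge0// ltW.
    exact: ler_wpM2l z2 _ _ (ltW (ln_sublinear X0)).
  rewrite -[in leRHS]XX [leRHS]mulrAC ler_pM2r//.
  by move: h; rewrite ler_pdivrMr.
apply: (@le_trans _ _ (ln (2 ^ k)%:R)).
  by rewrite natrX lnXn// -[ln _ *+ _]mulr_natl ler_pM2r// ler_nat.
by rewrite ler_ln ?posrE ?ltr0n ?a0 ?expn_gt0// ler_nat H.
Qed.

End digit_growth.

(** * Null and non-null Hausdorff measures of the sets [E] *)

Section exponent_sets.
Context {R : realType} {d : R} {f : nat -> R -> R}.
Hypotheses (d_gt1 : 1 < d) (hf : decaying_gauss_like d f).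
Context {m : nat} {t : 'I_m.+1 -> R}.
Hypothesis t_ge0 : forall i, 0 <= t i.
Hypothesis S_gt0 : 0 < \sum_(i < m.+1) t i.
Implicit Types (a : nat -> nat) (n k : nat) (A s : R) (alpha : \bar R).
Local Notation Sigma := (\sum_(i < m.+1) t i).
Local Notation E alpha := (E_set f (Lambda f) alpha t).
Local Notation I01 := `[0, 1 : R].

Let mono_code a := forall k l, (0 < k)%N -> (k <= l)%N -> (a k <= a l)%N.

Let upper_lipschitz e : 0 < e -> e < d -> exists2 C, 1 <= C &
  forall i x y, (0 < i)%N -> x \in I01 -> y \in I01 ->
    `|f i x - f i y| <= C / i%:R `^ e * `|x - y|.
Proof.
move=> e0 ed; have eps0 : 0 < d - e by rewrite subr_gt0.
have [C1 [C2 [_ C21 H]]] := dgl_bilipschitz hf eps0; exists C2 => // i x y i0 x01 y01.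
by have /andP[_] := H i x y i0 x01 y01; rewrite subKr.
Qed.

Let code_of_E alpha x : E alpha x -> exists a, [/\ codings f x a, mono_code a &
  limn_einf (fun n => (growth_exponent t a n)%:E) = alpha].
Proof.
move=> [[x01 [a [xa _]] dmono] Ealpha]; exists (digit f x); split => //.
  by apply: xgetPex; exists a.
move=> k l k0 /subnKC <-; elim: (l - k)%N => [|n ih]; first by rewrite addn0.
rewrite addnS; apply: (leq_trans ih); apply: dmono.
by rewrite addn_gt0 k0.
Qed.

Let eventually_ge alpha A a : positive_code a -> mono_code a ->
  limn_einf (fun n => (growth_exponent t a n)%:E) = alpha -> (A%:E < alpha)%E ->
  exists N, forall n, (N <= n)%N -> n%:R `^ (A / Sigma) <= (a (n + m)%N)%:R.
Proof.
move=> a0 am <- /limn_einf_gt[N HN]; exists (maxn 2 N) => n.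
rewrite geq_max => /andP[n1 Nn].
by apply: growth_exponent_gt => //; rewrite -lte_fin; exact: HN.
Qed.

Let infinitely_often_le alpha A a : positive_code a -> mono_code a ->
  limn_einf (fun n => (growth_exponent t a n)%:E) = alpha -> (alpha < A%:E)%E ->
  forall N, exists2 n, (N <= n)%N & (a n)%:R <= n%:R `^ (A / Sigma).
Proof.
move=> a0 am <- /limn_einf_lt H N; have [n] := H (maxn 2 N).
rewrite geq_max => /andP[n1 Nn]; rewrite lte_fin => h; exists n => //.
exact: growth_exponent_lt.
Qed.

Let code_infty_of_eventually_ge a (p : R) N : 0 < p -> mono_code a ->
  (forall n, (N <= n)%N -> n%:R `^ p <= (a (n + m)%N)%:R) ->
  forall B, exists M, forall k, (M < k)%N -> (B <= a k)%N.
Proof.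
move=> p0 am aN B; have [N' HN'] := @powR_nat_eventually_ge R B%:R _ p0.
pose n := maxn N N'; exists (n + m)%N => k nk.
have h : (B <= a (n + m)%N)%N.
  by rewrite -(ler_nat R) (le_trans (HN' n _)) ?aN ?leq_maxl ?leq_maxr.
(* Monotonicity starts at position 1; if [n + m = 0], the choice of [N'] forces [B = 0]. *)
have [nm0|nm0] := posnP (n + m)%N; last by apply: (leq_trans h); apply: am => //; exact: ltnW.
have := HN' n (leq_maxr _ _); have -> : n = 0%N by move: nm0; clear; lia.
rewrite powR0 ?gt_eqF// -[leRHS]/(0%:R) ler_nat leqn0 => /eqP->.
by [].
Qed.

Lemma hausdorff_measure_E_small (z s : R) : 0 < s -> 0 <= z -> z < Sigma ->
  hausdorff_measure s (E z%:E) = 0%E.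
Proof.
move=> s0 z0 zS; have [e [e0 ed]] : exists e, 0 < e /\ e < d by exists 1.
have [C C1 flam] := upper_lipschitz e0 ed.
(* Strictly between [z / Sigma] and 1, so that [a n <= n^c] infinitely often. *)
pose c := ((z + Sigma) / 2) / Sigma.
have c0 : 0 <= c by rewrite !divr_ge0// ?addr_ge0// ltW.
have c1 : c < 1 by rewrite ltr_pdivrMr//; lra.
have H1 := @hausdorff_measure0_bounded_digits R f s s0.
have H2 := hausdorff_measure0_slow_digits (dgl_mem hf) C1 e0 flam s0 c0 c1.
set A1 := [set x | _] in H1; set A2 := [set x | _] in H2.
apply: (@hausdorff_measure0_sub _ _ _ (\bigcup_b if b then A1 else A2)); last first.
  by apply: hausdorff_measure0_countable_bigcup => -[].
move=> x /code_of_E[a [xa am az]]; have [_ a0 _] := xa.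
have [abnd|ainf] := pselect (exists B, forall k, (a k <= B)%N).
  by exists true => //; exists a.
exists false => //; exists a; split => //.
  move=> B; apply: contrapT => /forallNP H; apply: ainf; exists (maxn (a 0%N) B) => k.
  have [->|k0] := posnP k; first exact: leq_maxl.
  have /existsNP[l /not_implyP[kl /negP]] := H k; rewrite -ltnNge => alB.
  by rewrite leq_max (leq_trans (am k l k0 (ltnW kl)) (ltnW alB)) orbT.
by apply: (infinitely_often_le a0 am az); rewrite lte_fin; lra.
Qed.

Lemma hausdorff_measure_E_middle (z s : R) : 0 < s -> Sigma <= z ->
  (z - Sigma) / (d * z) < s -> hausdorff_measure s (E z%:E) = 0%E.
Proof.
move=> s0 Sz sz; have z0 : 0 < z by exact: lt_le_trans Sz.
pose b := z / Sigma.
have b1 : 1 <= b by rewrite ler_pdivlMr// mul1r.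
have d0 : 0 < d by exact: lt_trans d_gt1.
have gap : 0 < s * d * b - b + 1.
  move: sz; rewrite ltr_pdivrMr ?mulr_gt0// => h.
  have -> : s * d * b - b + 1 = (s * (d * z) - (z - Sigma)) / Sigma.
    by rewrite /b; field; rewrite gt_eqF.
  by rewrite divr_gt0// subr_gt0.
(* Expanding [b + eta < 1 + s (d - eta) (b - eta)] requires [eta (1 + s (d + b)) - s eta^2] to be
   less than [s d b - b + 1]; [D] exceeds the coefficient of [eta]. *)
pose D := 2 + s * (d + b).
have D2 : 2 < D by rewrite /D ltrDl mulr_gt0// addr_gt0//; lra.
have D0 : 0 < D by lra.
pose eta := Num.min (2^-1) ((s * d * b - b + 1) / D).
have eta0 : 0 < eta by rewrite lt_min invr_gt0 ltr0n/= divr_gt0.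
have eta2 : eta <= 2^-1 by rewrite ge_min lexx.
have etaD : eta * D <= s * d * b - b + 1 by rewrite -ler_pdivlMr// ge_min lexx orbT.
clearbody eta; pose e := d - eta; have d1 := d_gt1.
have e0 : 0 < e by rewrite /e; lra.
have ed : e < d by rewrite /e; lra.
have [C C1 flam] := upper_lipschitz e0 ed.
have b10 : 0 < b - eta by lra.
have b21 : 1 < b + eta by lra.
have sb : b + eta < 1 + s * (e * (b - eta)).
  have : 0 < s * eta * eta by rewrite !mulr_gt0.
  have -> : s * (e * (b - eta)) = s * d * b - eta * (s * (d + b)) + s * eta * eta.
    by rewrite /e; ring.
  move: etaD; rewrite /D mulrDr; lra.
have := hausdorff_measure0_polynomial_digits (dgl_mem hf) C1 e0 flam s0 b10 b21 sb.
apply: hausdorff_measure0_sub => x /code_of_E[a [xa am az]].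
have [_ a0 _] := xa; exists a; split => //; last first.
  have -> : b + eta = (z + eta * Sigma) / Sigma by rewrite /b; field; rewrite gt_eqF.
  by apply: (infinitely_often_le a0 am az); rewrite lte_fin ltrDl mulr_gt0.
(* Half of [eta] is spent on the lower limit, the other half on the shift by [m]: [a k >= (k - m)^w
   >= (k / 2)^w >= k^(b - eta)] for large [k]. *)
have [w wE] : exists w, w = b - eta / 2 by exists (b - eta / 2).
have [N HN] : exists N, forall n, (N <= n)%N -> n%:R `^ w <= (a (n + m)%N)%:R.
  have -> : w = (z - eta / 2 * Sigma) / Sigma by rewrite wE /b; field; rewrite gt_eqF.
  apply: (eventually_ge a0 am az); rewrite lte_fin gtrDl oppr_lt0 mulr_gt0//.
  by rewrite divr_gt0.
have e20 : 0 < eta / 2 by rewrite divr_gt0.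
have [N' HN'] := @powR_nat_eventually_ge R (2 `^ w) _ e20.
exists (maxn (N + m) (maxn N' (2 * m))) => k; rewrite !gtn_max => /and3P[k1 k2 k3].
have mk : (m <= k)%N by rewrite (leq_trans _ (ltnW k1))// leq_addl.
have Nk : (N <= k - m)%N by rewrite leq_subRL// addnC ltnW.
have k2m : (k <= (k - m) * 2)%N by move: mk k3; clear; lia.
have := HN _ Nk; rewrite subnK//; apply: le_trans.
have k0 : 0 < k%:R :> R by rewrite ltr0n (leq_trans _ k1).
have w0 : 0 <= w by rewrite wE; lra.
apply: (@le_trans _ _ ((k%:R / 2) `^ w)); last first.
  rewrite ge0_ler_powR ?nnegrE ?divr_ge0 ?(ltW k0)//.
  by rewrite ler_pdivrMr// -natrM ler_nat.
have -> : (k%:R / 2) `^ w = k%:R `^ (b - eta) * k%:R `^ (eta / 2) / 2 `^ w.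
  have E2 : 2^-1 `^ w = (2 `^ w)^-1 :> R by rewrite -powR_inv1// -powRrM mulN1r powRN.
  rewrite powRM ?invr_ge0 ?(ltW k0)// E2.
  by rewrite -powRD ?(gt_eqF k0) ?implybT//; congr (_ `^ _ / _); rewrite wE; field.
rewrite ler_pdivlMr ?powR_gt0// ler_wpM2l ?powR_ge0//.
exact/HN'/ltnW.
Qed.

Lemma hausdorff_measure_E_infty s : 1 / d < s -> hausdorff_measure s (E +oo%E) = 0%E.
Proof.
move=> sd; have d0 : 0 < d by exact: lt_trans d_gt1.
have s0 : 0 < s by apply: le_lt_trans sd; rewrite divr_ge0// ltW.
move: sd; rewrite ltr_pdivrMr// => sd.
have sd' : s^-1 < d by rewrite -[ltLHS]mul1r ltr_pdivrMr// mulrC.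
pose e := (d + s^-1) / 2.
have si0 : 0 < s^-1 by rewrite invr_gt0.
have e0 : 0 < e by rewrite divr_gt0// addr_gt0.
have ed : e < d by rewrite /e; lra.
have se : 1 < s * e by rewrite -ltr_pdivrMl// mulr1 /e; lra.
have [C C1 flam] := upper_lipschitz e0 ed.
have := hausdorff_measure0_digits_infty (dgl_mem hf) C1 e0 flam s0 se.
apply: hausdorff_measure0_sub => x /code_of_E[a [xa am az]].
have [_ a0 _] := xa; exists a => //.
have [N HN] := eventually_ge (A := Sigma) a0 am az (ltry _).
by apply: (code_infty_of_eventually_ge _ am HN); rewrite divff ?gt_eqF.
Qed.

(* The abstract size condition [b <= c Y^p], [Y^r <= Q] covers both the
   polynomial ([Y = n]) and the exponential ([Y = 2^n]) windows. *)
Let window_growth (C1 e1 s c p r : R) : 0 < C1 -> 0 <= e1 -> 0 <= s -> 0 < c ->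
  p * (e1 * s) < r -> exists n0, forall n (Y b Q : R), (n0 <= n)%N -> (0 < n)%N ->
    n%:R <= Y -> 0 < b -> b <= c * Y `^ p -> Y `^ r <= Q -> 1 <= (C1 / b `^ e1) `^ s * Q.
Proof.
move=> C10 e10 s0 c0 pr; pose sg := e1 * s.
have sg0 : 0 <= sg by rewrite mulr_ge0.
have rp : 0 < r - p * sg by rewrite subr_gt0.
have [n0 Hn0] := @powR_nat_eventually_ge R (c `^ sg / C1 `^ s) _ rp.
exists n0 => n Y b Q nn n1 nY b0 bY YQ.
have Y0 : 0 < Y by apply: lt_le_trans nY; rewrite ltr0n.
have C1s : 0 < C1 `^ s by rewrite powR_gt0.
have be : 0 < b `^ sg by rewrite powR_gt0.
rewrite powRM ?invr_ge0 ?powR_ge0 ?(ltW C10)//.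
have -> : ((b `^ e1)^-1) `^ s = (b `^ sg)^-1 by rewrite -powRN -powRrM mulNr powRN.
rewrite mulrAC ler_pdivlMr// mul1r.
apply: (@le_trans _ _ ((c * Y `^ p) `^ sg)).
  by rewrite ge0_ler_powR ?nnegrE ?mulr_ge0 ?powR_ge0 ?(ltW b0) ?(ltW c0).
rewrite powRM ?powR_ge0 ?(ltW c0)// -powRrM.
apply: (@le_trans _ _ (C1 `^ s * Y `^ r)); last by rewrite ler_pM2l.
have -> : Y `^ r = Y `^ (p * sg) * Y `^ (r - p * sg).
  by rewrite -powRD ?(gt_eqF Y0) ?implybT// addrC subrK.
rewrite [leRHS]mulrCA [leLHS]mulrC ler_wpM2l ?powR_ge0// [leRHS]mulrC -ler_pdivrMr//.
apply: le_trans (Hn0 n nn) _.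
by rewrite ge0_ler_powR ?nnegrE ?(ltW rp) ?(ltW Y0).
Qed.

(** The bound on [u k + 2 * Q k] places each window weakly below the next, so every choice of digits
    is nondecreasing. As all digits are at least 2, the coding is unique and [digit] returns it. *)
Lemma hausdorff_measure_E_neq0 alpha s (u Q : nat -> nat) (c p r : R) (Y : nat -> R) :
  0 <= s -> 0 < c -> p * (d * s) < r ->
  (forall k, (0 < k)%N -> (1 < u k)%N) -> (forall k, (0 < k)%N -> (1 < Q k)%N) ->
  (forall k, (0 < k)%N -> (u k + 2 * Q k <= u k.+1 + 2)%N) ->
  (forall B, exists M, forall k, (M < k)%N -> (B <= u k)%N) ->
  (forall k, (0 < k)%N -> k%:R <= Y k) ->
  (forall k, (0 < k)%N -> (u k.+1 + 2 * Q k.+1)%:R <= c * Y k `^ p) ->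
  (forall k, (0 < k)%N -> Y k `^ r <= (Q k)%:R) ->
  (forall a, positive_code a ->
    (forall k, (0 < k)%N -> (u k <= a k)%N /\ (a k + 2 <= u k + 2 * Q k)%N) ->
    limn_einf (fun n => (growth_exponent t a n)%:E) = alpha) ->
  hausdorff_measure s (E alpha) != 0%E.
Proof.
move=> s0 c0 pr u1 Q1 uQ uinf Yk bY YQ ualpha.
have d0 : 0 < d by exact: lt_trans d_gt1.
(* The regularity bounds hold with exponent [d + eps] only; the strict inequality leaves room for a
   small [eps]. *)
have [eps [eps0 epsd prs]] : exists eps, [/\ 0 < eps, eps < d & p * ((d + eps) * s) < r].
  pose g := r - p * (d * s); have g0 : 0 < g by rewrite subr_gt0.
  have q0 : 0 < `|p * s| + 1 by rewrite ltr_wpDl.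
  exists (Num.min 1 (g / 2 / (`|p * s| + 1))); set eps := Num.min _ _.
  have eps0 : 0 < eps by rewrite lt_min ltr01 !divr_gt0.
  have eps1 : eps <= 1 by rewrite ge_min lexx.
  split => //; first exact: le_lt_trans d_gt1.
  have h : eps * (`|p * s| + 1) <= g / 2 by rewrite -ler_pdivlMr// ge_min lexx orbT.
  have h' : eps * (p * s) <= eps * (`|p * s| + 1).
    by rewrite ler_pM2l// (le_trans (ler_norm _))// lerDl.
  clearbody eps; rewrite mulrDl mulrDr; have -> : p * (eps * s) = eps * (p * s) by ring.
  by move: h; rewrite /g; lra.
have [C1 [C2 [/andP[C10 _] C21 H]]] := dgl_bilipschitz hf eps0.
have flo i x y : (0 < i)%N -> x \in I01 -> y \in I01 ->
    C1 / i%:R `^ (d + eps) * `|x - y| <= `|f i x - f i y|.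
  by move=> i0 x01 y01; have /andP[] := H i x y i0 x01 y01.
have fup i x y : (0 < i)%N -> x \in I01 -> y \in I01 ->
    `|f i x - f i y| <= C2 / i%:R `^ (d - eps) * `|x - y|.
  by move=> i0 x01 y01; have /andP[] := H i x y i0 x01 y01.
have e10 : 0 <= d + eps by rewrite addr_ge0// ltW.
have e20 : 0 < d - eps by rewrite subr_gt0.
have xi0 i : (0 < i)%N -> 0 < C1 / i%:R `^ (d + eps).
  by move=> i0; rewrite divr_gt0// powR_gt0// ltr0n.
have [n0 Hn0] := window_growth C10 e10 s0 c0 prs.
apply: (hausdorff_measure_window_neq0 (n0 := maxn 1 n0) hf C10 e10 flo C21 e20 fup s0 u1 Q1 uinf).
  move=> n; rewrite geq_max => /andP[n1 nn].
  apply: (Hn0 n (Y n)) => //; [exact: Yk| |exact: bY|exact: YQ].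
  by rewrite ltr0n addn_gt0 ltnW ?u1.
move=> a x xa aw.
have a1 k : (0 < k)%N -> (1 < a k)%N.
  by move=> k0; have [h _] := aw k k0; exact: leq_trans (u1 _ k0) h.
have au := codings_unique hf xi0 flo a1 xa.
have dE : digit f x = a.
  by apply/esym/au; apply: xgetPex; exists a.
have a0 : positive_code a by case: xa.
split; last by rewrite dE; exact: ualpha.
split; first exact: (codings_interior hf xi0 flo a1 xa).
  by exists a; split.
move=> n n1; rewrite dE; have [_ h1] := aw n n1; have [h2 _] := aw n.+1 isT.
by move: h1 h2 (uQ n n1); clear; lia.
Qed.

Lemma hausdorff_measure_E_middle_neq0 (z s : R) : 0 <= s ->
  s < (z - Sigma) / (d * z) -> Sigma <= z -> hausdorff_measure s (E z%:E) != 0%E.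
Proof.
move=> s0 sz Sz; have z0 : 0 < z by exact: lt_le_trans Sz.
have d0 : 0 < d by exact: lt_trans d_gt1.
pose b := z / Sigma.
have b1 : 1 <= b by rewrite ler_pdivlMr// mul1r.
have b0 : 0 < b by lra.
have gap : b * (d * s) < b - 1.
  move: sz; rewrite ltr_pdivlMr ?mulr_gt0// => h.
  have -> : b * (d * s) = (s * (d * z)) / Sigma by rewrite /b; field; rewrite gt_eqF.
  have -> : b - 1 = (z - Sigma) / Sigma by rewrite /b; field; rewrite gt_eqF.
  by rewrite ltr_pM2r// invr_gt0.
pose fl (p : R) k := Num.truncn (k%:R `^ p : R).
(* The factor 2 matches the step 2 between digits. The summand 2 makes digits exceed 1 and [k^b],
   and the summand 1 gives [Q k >= 2] and [Q k >= k^(b - 1)]. *)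
pose u k := (2 * fl b k + 2)%N; pose Q k := (fl (b - 1)%R k + 1)%N.
have fl_le p k : (fl p k)%:R <= k%:R `^ p :> R by rewrite truncn_le powR_ge0.
have fl_gt p k : k%:R `^ p < (fl p k).+1%:R :> R by exact: truncnS_gt.
have kb k : (0 < k)%N -> k%:R `^ b = k%:R * k%:R `^ (b - 1) :> R.
  move=> k0; have k0' : 0 < k%:R :> R by rewrite ltr0n.
  rewrite -{2}(powRr1 (ltW k0')) -powRD ?(gt_eqF k0') ?implybT//.
  by congr (_ `^ _); ring.
have uQ_le k : (0 < k)%N -> (u k + 2 * Q k)%:R <= 8 * k%:R `^ b :> R.
  move=> k0; have h1 := fl_le b k; have h2 := fl_le (b - 1) k.
  have h3 : k%:R `^ (b - 1) <= k%:R `^ b :> R.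
    by rewrite ler_powR ?ler1n//; lra.
  have h4 := nat_powR_ge1 k0 (ltW b0) : 1 <= k%:R `^ b :> R.
  have -> : (u k + 2 * Q k = 2 * (fl b k + fl (b - 1)%R k) + 4)%N by rewrite /u /Q; clear; lia.
  rewrite natrD natrM natrD; lra.
apply: (@hausdorff_measure_E_neq0 _ _ u Q (8 * 2 `^ b) b (b - 1) (fun k => k%:R)) => //.
- by move=> k _; rewrite /u; clear; lia.
- move=> k k0; have : (0 < fl (b - 1)%R k)%N.
    by rewrite truncn_gt0 nat_powR_ge1//; lra.
  by rewrite /Q; clear; lia.
(* Consecutive windows fit because [(k + 1)^b >= k^b + k^(b - 1)]. *)
- move=> k k0; suff h : (fl b k + fl (b - 1)%R k <= fl b k.+1)%N by move: h; rewrite /u /Q; clear; lia.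
  rewrite truncn_ge_nat ?powR_ge0// natrD.
  apply: (le_trans (lerD (fl_le _ _) (fl_le _ _))).
  rewrite (kb _ k0) (kb k.+1)// -natr1 mulrDl mul1r.
  have h : k%:R `^ (b - 1) <= (k%:R + 1) `^ (b - 1) :> R.
    have b10 : 0 <= b - 1 by rewrite subr_ge0.
    by rewrite (ge0_ler_powR b10) ?nnegrE ?lerDl ?addr_ge0.
  by rewrite lerD// ler_wpM2l.
- move=> B; have [N HN] := @powR_nat_eventually_ge R B%:R _ b0.
  exists N => k /ltnW /HN h; have := le_lt_trans h (fl_gt b k).
  by rewrite ltr_nat /u; clear; lia.
- move=> k k0; apply: (le_trans (uQ_le _ _)) => //.
  rewrite -mulrA ler_pM2l// -powRM// (ge0_ler_powR (ltW b0)) ?nnegrE ?mulr_ge0//.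
  by rewrite -natrM ler_nat; move: k0; clear; lia.
- by move=> k k0; rewrite /Q addn1 ltW.
move=> a a0 aw; have -> : z = b * Sigma by rewrite /b divfK ?gt_eqF.
apply: (growth_exponent_cvg_power (c := 8) t_ge0 (ltW b0)) => // k k0.
have [h1 h2] := aw k k0; apply/andP; split.
  by apply: (le_trans (ltW (fl_gt b k))); rewrite ler_nat (leq_trans _ h1)// /u; clear; lia.
apply: le_trans (uQ_le _ k0); rewrite ler_nat (leq_trans _ h2)//; clear; lia.
Qed.

Lemma hausdorff_measure_E_infty_neq0 s : 0 <= s -> s < 1 / d ->
  hausdorff_measure s (E +oo%E) != 0%E.
Proof.
move=> s0; have d0 : 0 < d by exact: lt_trans d_gt1.
rewrite ltr_pdivlMr// => sd.
(* The windows abut: [u k + 2 Q k = 2^(k + 2) = u (k + 1)]. With [Y = 2^k] and [p = r = 1] the size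
   condition reads [d s < 1]. *)
pose u k := (2 ^ k.+1)%N; pose Q k := (2 ^ k)%N.
have e2 (k : nat) : (0 < 2 ^ k)%N by rewrite expn_gt0.
have p2 (k : nat) : (k < 2 ^ k)%N by exact: ltn_expl.
apply: (@hausdorff_measure_E_neq0 _ _ u Q 8 1 1 (fun k => (2 ^ k)%:R)) => //.
- by rewrite mul1r mulrC.
- by move=> k k0; rewrite /u expnS; have := e2 k; clear; lia.
- by move=> k k0; move: k0 (p2 k); rewrite /Q; clear; lia.
- by move=> k k0; rewrite /u /Q !expnS; clear; lia.
- by move=> B; exists B => k Bk; move: Bk (p2 k); rewrite /u expnS; clear; lia.
- by move=> k _; rewrite ler_nat ltnW.
- by move=> k _; rewrite powRr1// -natrM ler_nat /u /Q !expnS; clear; lia.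
- by move=> k _; rewrite powRr1.
move=> a a0 aw; apply: growth_exponent_cvg_exponential => // k k0.
have [h _] := aw k k0; apply: leq_trans h.
by rewrite /u expnS; have := e2 k; clear; lia.
Qed.

End exponent_sets.

Unset Implicit Arguments.

Theorem theorem1p8 (R : realType) (d : R) (hd : 1 < d)
    (f : nat -> R -> R) (hf : decaying_gauss_like d f)
    (m : nat) (hm : (1 <= m)%N) (t : 'I_m.+1 -> R)
    (ht : forall i, 0 <= t i) (ht0 : t ord0 != 0)
    (hti : exists i : 'I_m.+1, (1 <= i)%N /\ t i != 0)
    (alpha : \bar R) (halpha : (0 <= alpha)%E) :
  let Sigma_t := \sum_(i < m.+1) t i in
  hausdorff_dim (E_set f (Lambda f) alpha t) =
    if (alpha < Sigma_t%:E)%E then 0%:E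
    else if (alpha < +oo)%E then
      ((fine alpha - Sigma_t) / (d * fine alpha))%:E
    else (1 / d)%:E.
Proof.
move=> Sigma.
have d0 : 0 < d by exact: lt_trans hd.
have S0 : 0 < Sigma.
  rewrite /Sigma (bigD1 ord0)//= ltr_wpDr ?sumr_ge0//.
  by rewrite lt_neqAle eq_sym ht0 ht.
have [alphaS|] := ltP alpha Sigma%:E.
  case: alpha halpha alphaS => [z| |]//; rewrite lee_fin lte_fin => z0 zS.
  apply/eqP; rewrite eq_le hausdorff_dim_ge0 andbT.
  apply: hausdorff_dim_le => // s s0.
  exact: (hausdorff_measure_E_small hd hf ht S0).
case: alpha halpha => [z| |]//= z0; last first.
  move=> _; apply/eqP; rewrite eq_le; apply/andP; split.
    apply: hausdorff_dim_le; first by rewrite divr_ge0// ltW.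
    by move=> s sd; exact: (hausdorff_measure_E_infty hd hf ht S0).
  apply: hausdorff_dim_ge => s s0 sd.
  exact: (hausdorff_measure_E_infty_neq0 hd hf ht S0).
rewrite lee_fin ltry => Sz.
have z0' : 0 < z by exact: lt_le_trans Sz.
have dz : 0 <= (z - Sigma) / (d * z).
  by rewrite divr_ge0 ?subr_ge0// mulr_ge0// ltW.
apply/eqP; rewrite eq_le; apply/andP; split.
  apply: hausdorff_dim_le => // s sz.
  apply: (hausdorff_measure_E_middle hd hf ht S0) => //.
  exact: le_lt_trans sz.
apply: hausdorff_dim_ge => s s0 sz.
exact: (hausdorff_measure_E_middle_neq0 hd hf ht S0).
Qed.
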